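(* Let $(F,G)\in\mathbb{C}[x,y]^2$ be a Jacobian pair whose Keller map is not injective. Then there exists a $\mathbb{C}$-algebra automorphism $\phi$ of $\mathbb{C}[x,y]$ such that the Jacobian pair $(F',G')=(\phi(F),\phi(G))$ has the following property. Let $V$ be the set of all $(p_1,p_2)=((x_1,y_1),(x_2,y_2))\in\mathbb{C}^2\times\mathbb{C}^2$ with $p_1\neq p_2$ and $(F'(p_1),G'(p_1))=(F'(p_2),G'(p_2))$, and put $h_{p_1,p_2}=|x_1|+|y_1|+|x_2|+|y_2|$. Then, for $(p_1,p_2)\in V$, when $h_{p_1,p_2}\to\infty$ one has $|y_1|+|y_2|=o(h_{p_1,p_2})$; that is, for every $\varepsilon>0$ there is $R>0$ such that $|y_1|+|y_2|\le\varepsilon\, h_{p_1,p_2}$ for all $(p_1,p_2)\in V$ with $h_{p_1,p_2}\ge R$.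
   Context: A Jacobian pair is a pair $(F,G)\in\mathbb{C}[x,y]^2$ with $J(F,G)=\frac{\partial F}{\partial x}\frac{\partial G}{\partial y}-\frac{\partial F}{\partial y}\frac{\partial G}{\partial x}\in\mathbb{C}\setminus\{0\}$; its Keller map is $\sigma:\mathbb{C}^2\to\mathbb{C}^2$, $p\mapsto(F(p),G(p))$. *)

(* Defs.v *)
From mathcomp Require Import all_boot all_order all_algebra.
From mathcomp Require Import reals.
From mathcomp Require Import complex.
From mathcomp.multinomials Require Import mpoly.

Set Implicit Arguments.
Unset Strict Implicit.
Unset Printing Implicit Defensive.

Import GRing.Theory Num.Theory.
Local Open Scope ring_scope.

(* [R[i]] is the field of complex numbers, [R] being a model of the reals.
   The variable of index [ix] is x and the variable of index [iy] is y. *)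
Definition ix : 'I_2 := @Ordinal 2 0 isT.
Definition iy : 'I_2 := @Ordinal 2 1 isT.

Definition jacobian (K : comNzRingType) (F G : {mpoly K[2]}) : {mpoly K[2]} :=
  F^`M(ix) * G^`M(iy) - F^`M(iy) * G^`M(ix).

Definition jacobian_pair (R : realType) (F G : {mpoly R[i][2]}) : Prop :=
  exists2 c : R[i], c != 0 & jacobian F G = c%:MP.

Definition eval_at (K : comNzRingType) (F : {mpoly K[2]}) (p : K * K) : K :=
  F.@[fun i => if i == ix then p.1 else p.2].

Definition keller_map (K : comNzRingType) (F G : {mpoly K[2]})
  (p : K * K) : K * K := (eval_at F p, eval_at G p).

Definition double_points (K : comNzRingType) (F G : {mpoly K[2]})
  (p1 p2 : K * K) : Prop :=
  p1 <> p2 /\ keller_map F G p1 = keller_map F G p2.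

(* The library's [`|z|] lives in [R[i]]; [cabs z] is the same modulus in [R]. *)
Definition cabs (R : realType) (z : R[i]) : R := ComplexField.Normc.normc z.

Definition height (R : realType) (p1 p2 : R[i] * R[i]) : R :=
  cabs p1.1 + cabs p1.2 + cabs p2.1 + cabs p2.2.

(* Main.v *)
Require Import Defs.
From mathcomp Require Import all_boot all_order all_algebra.
From mathcomp Require Import reals.
From mathcomp Require Import complex.
From mathcomp.multinomials Require Import mpoly.
From mathcomp Require Import ring zify.

(** The automorphism is [x -> x + y ^ k, y -> y + t * (x + y ^ k)] for a generic
    direction [t] and a large exponent [k].  Write [X = x + y ^ k].  The new
    coordinates are [F (X, y + t * X)] and [G (X, y + t * X)]; for generic [t]
    the first one is, up to a constant, a polynomial [B] that is monic in [X],
    of some degree [a] ([monic_shear]).  Call [H] the second one.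

    Let [Y = |y1| + |y2|] and consider double points with [Y > eps * h].  Their
    first coordinates are [O (Y)], hence [X] equals [y ^ k] up to [O (Y)], and it
    is enough to show that [Y] is bounded on such double points
    ([dominated_double_points_bounded]).

    Near [X = oo], [B] has an [a]-th root [Z = X + z (1 / X, y)] with an error of
    arbitrarily high order in [1 / X], and the Jacobian condition forces the
    coefficients of [B * H], expanded in powers of [Z], to be constants, until
    the order where the constant [c] of the Jacobian appears: for some
    polynomial [P] with constant coefficients,
      [B * H = P (Z) + (c / a) * X * y + r (1 / X, y)]
    ([asymptotic_expansion]).

    At a double point the values of [B] agree, so [y1] and [y2] both have the
    order of [Y], and [Z1 ^ a] is extremely close to [Z2 ^ a].  Hence [Z1] is
    extremely close to [w * Z2] for some root of unity [w] of order dividing [a],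
    and the equality of the values of [B * H] is then contradictory for large
    [Y].
    - If [w <> 1] ([distinct_roots_bounded]), it bounds
      [(P (w * Z2) - P (Z2)) / Z2 + (c / a) * (w * y1 - y2)].  As [Z2] has order
      [Y ^ k], the polynomial in [Z2] must be constant, so that [w * y1 - y2] is
      bounded; as [a] divides [k], [y1 ^ k] and [y2 ^ k] are close, so [X1] is
      close to [X2] as well as to [w * X2].
    - If [w = 1] ([close_roots_bounded]), all differences are multiples of
      [y1 - y2].  Dividing the difference of the two expansions by it leaves
      [(c / a) * X1 = O (Y ^ (K0 + 1))], where [K0] bounds the degrees in [y]
      and does not depend on [k], whereas [X1] has order [Y ^ k]. *)
Set Implicit Arguments.
Unset Strict Implicit.
Unset Printing Implicit Defensive.
Import Order.TTheory GRing.Theory Num.Theory.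
Local Open Scope ring_scope.

(** * Polynomials in two variables and weighted derivations *)

Section BivariateAlgebra.
Variable K : fieldType.
Implicit Types (u v w U V : {poly {poly K}}) (N M l : nat).

(** Such a polynomial stands for a function of [X], or of [t = 1 / X], the outer
    variable, and of [y], the inner one. *)
Definition ev2 U (x y : K) : K := U.[x%:P].[y].

Lemma ev2D U V x y : ev2 (U + V) x y = ev2 U x y + ev2 V x y.
Proof. by rewrite /ev2 !hornerD. Qed.

Lemma ev2M U V x y : ev2 (U * V) x y = ev2 U x y * ev2 V x y.
Proof. by rewrite /ev2 !hornerM. Qed.

Lemma ev2_exp U n x y : ev2 (U ^+ n) x y = ev2 U x y ^+ n.
Proof. by rewrite /ev2 !horner_exp. Qed.

Lemma ev2N U x y : ev2 (- U) x y = - ev2 U x y.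
Proof. by rewrite /ev2 !hornerN. Qed.

Lemma ev2X x y : ev2 'X x y = x.
Proof. by rewrite /ev2 hornerX hornerC. Qed.

Lemma ev2C (p : {poly K}) x y : ev2 p%:P x y = p.[y].
Proof. by rewrite /ev2 hornerC. Qed.

Lemma ev2_sum (I : Type) (s : seq I) (P : pred I) (f : I -> {poly {poly K}}) x y :
  ev2 (\sum_(i <- s | P i) f i) x y = \sum_(i <- s | P i) ev2 (f i) x y.
Proof. by rewrite /ev2 !horner_sum. Qed.

Definition dy U : {poly {poly K}} := map_poly (@deriv K) U.

Lemma coef_dy U i : (dy U)`_i = (U`_i)^`().
Proof. by rewrite coef_map_id0 ?deriv0. Qed.

Lemma dyD U V : dy (U + V) = dy U + dy V.
Proof. by apply/polyP => i; rewrite coefD !coef_dy coefD derivD. Qed.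

Lemma dyM U V : dy (U * V) = dy U * V + U * dy V.
Proof.
apply/polyP => i; rewrite coefD coef_dy !coefM raddf_sum -big_split /=.
by apply: eq_bigr => j _; rewrite derivM !coef_dy.
Qed.

Lemma dyC (p : {poly K}) : dy p%:P = (p^`())%:P.
Proof. by apply/polyP => i; rewrite coef_dy !coefC; case: eqP => // _; rewrite deriv0. Qed.

Lemma dyXn n : dy 'X^n = 0.
Proof.
by apply/polyP => i; rewrite coef_dy coefXn coef0; case: eqP; rewrite ?derivC // deriv0.
Qed.

Lemma dyX : dy 'X = 0.
Proof. exact: (dyXn 1). Qed.

Lemma dy_exp U n : dy (U ^+ n) = U ^+ n.-1 * dy U *+ n.
Proof.
elim: n => [|n IH]; first by rewrite expr0 dyC derivC mulr0n.
rewrite exprS dyM IH /= mulrSr addrC [dy U * _]mulrC; congr (_ + _).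
by case: n {IH} => [|n]; rewrite ?mulr0n ?mulr0 // mulrnAr mulrA -exprS.
Qed.

(** For [t = 1 / X], this is the derivation [X * d/dX] transported to the
    series [u] such that the function at hand is [X ^ N * u]. *)
Definition theta N u : {poly {poly K}} := u *+ N - 'X * u^`().

Lemma thetaM N M u v : theta (N + M) (u * v) = theta N u * v + u * theta M v.
Proof. by rewrite /theta derivM; ring. Qed.

Lemma theta_exp N u n : theta (N * n) (u ^+ n) = u ^+ n.-1 * theta N u *+ n.
Proof.
elim: n => [|n IH]; first by rewrite muln0 /theta expr0 derivC mulr0 subr0 !mulr0n.
rewrite mulnS exprS thetaM IH /= mulrSr addrC [theta N u * _]mulrC; congr (_ + _).
by case: n {IH} => [|n]; rewrite ?mulr0n ?mulr0 // mulrnAr mulrA -exprS.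
Qed.

Lemma thetaXn N l u : theta N ('X^l * u) = 'X^l * (theta N u - u *+ l).
Proof.
rewrite /theta derivM derivXn; case: l => [|l] /=; first by rewrite mulr0n; ring.
by rewrite exprS; ring.
Qed.

(** The Poisson bracket, multiplied by [X], of the functions [X ^ N * u] and
    [X ^ M * v]. *)
Definition bracket N M u v := theta N u * dy v - dy u * theta M v.

Lemma bracketDr N M u v w :
  bracket N M u (v + w) = bracket N M u v + bracket N M u w.
Proof. by rewrite /bracket dyD /theta derivD; ring. Qed.

Lemma bracketDl N M u v w :
  bracket N M (u + v) w = bracket N M u w + bracket N M v w.
Proof. by rewrite /bracket dyD /theta derivD; ring. Qed.

Lemma bracketCr N M u v (p : K) :
  bracket N M u (p%:P%:P * v) = p%:P%:P * bracket N M u v.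
Proof. by rewrite /bracket dyM dyC derivC /theta derivM derivC; ring. Qed.

Lemma bracket_sumr N M u (I : Type) (s : seq I) (f : I -> {poly {poly K}}) :
  bracket N M u (\sum_(i <- s) f i) = \sum_(i <- s) bracket N M u (f i).
Proof.
elim: s => [|i s IH]; last by rewrite !big_cons bracketDr IH.
by rewrite !big_nil /bracket /theta /dy map_poly0 deriv0; ring.
Qed.

Lemma bracket_selfM N M u v : bracket N (N + M) u (u * v) = u * bracket N M u v.
Proof. by rewrite /bracket dyM thetaM; ring. Qed.

Lemma bracket_Xnl N M l u v :
  exists w, bracket N M ('X^l * u) v = 'X^l * w.
Proof.
exists ((theta N u - u *+ l) * dy v - dy u * theta M v).
by rewrite /bracket thetaXn dyM dyXn; ring.
Qed.

(** The two arguments stand for powers of the same function [X * z]. *)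
Lemma bracket_powers z a N j : (j <= N)%N ->
  bracket a N (z ^+ a) ('X^j * z ^+ (N - j)) = 0.
Proof.
move=> lejN; rewrite /bracket thetaXn dyM dyXn !dy_exp.
have e1 : theta a (z ^+ a) = z ^+ a.-1 * theta 1 z *+ a by rewrite -theta_exp mul1n.
have e2 : theta N (z ^+ (N - j)) - z ^+ (N - j) *+ j = z ^+ (N - j).-1 * theta 1 z *+ (N - j).
  rewrite -theta_exp mul1n; set v := z ^+ _.
  by rewrite -[in theta N _](subnK lejN) /theta mulrnDr; ring.
by rewrite e1 e2; ring.
Qed.

(** * Reversal of a polynomial *)

(** At formal degree [N]: [U (X) = X ^ N * hom N U (1 / X)]. *)
Definition hom N U : {poly {poly K}} := \sum_(i < N.+1) U`_i *: 'X^(N - i).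

Lemma homD N U V : hom N (U + V) = hom N U + hom N V.
Proof. by rewrite /hom -big_split; apply: eq_bigr => i _; rewrite coefD scalerDl. Qed.

Lemma hom_sum N (I : Type) (s : seq I) (f : I -> {poly {poly K}}) :
  hom N (\sum_(i <- s) f i) = \sum_(i <- s) hom N (f i).
Proof.
elim: s => [|i s IH]; last by rewrite !big_cons homD IH.
by rewrite !big_nil /hom big1 // => i _; rewrite coef0 scale0r.
Qed.

Lemma hom_monomial N p i : (i <= N)%N -> hom N (p *: 'X^i) = p *: 'X^(N - i).
Proof.
move=> leiN; rewrite /hom (bigD1 (Ordinal (leiN : (i < N.+1)%N))) //= coefZ coefXn eqxx mulr1.
rewrite big1 ?addr0 // => j; rewrite -val_eqE /= => /negPf nji.
by rewrite coefZ coefXn nji mulr0 scale0r.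
Qed.

Lemma poly_coefE U N : (size U <= N.+1)%N -> U = \sum_(i < N.+1) U`_i *: 'X^i.
Proof.
move=> sU; rewrite -poly_def; apply/polyP => i; rewrite coef_poly.
by case: ltnP => // leNi; rewrite nth_default // (leq_trans sU).
Qed.

Lemma monoM (p q : {poly K}) i j :
  (p *: 'X^i) * (q *: 'X^j) = (p * q) *: 'X^(i + j) :> {poly {poly K}}.
Proof. by rewrite -!mul_polyC polyCM exprD; ring. Qed.

Lemma homM N M U V : (size U <= N.+1)%N -> (size V <= M.+1)%N ->
  hom (N + M) (U * V) = hom N U * hom M V.
Proof.
move=> sU sV; rewrite {1}(poly_coefE sU) {1}(poly_coefE sV) mulr_suml hom_sum {2}/hom mulr_suml.
apply: eq_bigr => i _; rewrite mulr_sumr hom_sum {2}/hom mulr_sumr.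
apply: eq_bigr => j _.
transitivity (hom (N + M) ((U`_i * V`_j) *: 'X^(i + j))); first by rewrite -monoM.
have lei := ltn_ord i : (i <= N)%N; have lej := ltn_ord j : (j <= M)%N.
rewrite monoM hom_monomial ?leq_add //.
congr (_ *: 'X^_).
by have := ltn_ord i; have := ltn_ord j; lia.
Qed.

Lemma coef0_hom N U : (hom N U)`_0 = U`_N.
Proof.
rewrite /hom coef_sum (bigD1 ord_max) //= subnn expr0 coefZ coef1 mulr1.
rewrite big1 ?addr0 // => i; rewrite -val_eqE /= coefZ coefXn => niN.
by have := ltn_ord i; case: eqP; rewrite ?mulr0 //; lia.
Qed.

Lemma coefM_top N M U V : (size U <= N.+1)%N -> (size V <= M.+1)%N ->
  (U * V)`_(N + M) = U`_N * V`_M.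
Proof.
by move=> sU sV; rewrite -coef0_hom homM // -horner_coef0 hornerM !horner_coef0 !coef0_hom.
Qed.

Lemma dy_hom N U : dy (hom N U) = hom N (dy U).
Proof.
rewrite /hom (big_morph dy dyD (id1 := 0)); last by rewrite /dy map_poly0.
apply: eq_bigr => i _; rewrite coef_dy -!mul_polyC dyM dyC dyXn; ring.
Qed.

Lemma theta_hom N U : theta N (hom N U) = hom N ('X * U^`()).
Proof.
rewrite /theta /hom raddf_sum -sumrMnl mulr_sumr -sumrB; apply: eq_bigr => i _ /=.
have -> : ('X * U^`())`_i = U`_i *+ i.
  by rewrite coefXM coef_deriv; case: i => [[|i] lti] //=; rewrite ?mulr0n.
rewrite linearZ /= derivXn -!mul_polyC polyCMn.
have eN : N = (i + (N - i))%N by rewrite subnKC // -ltnS.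
move: (N - i)%N eN (U`_i) => n eN p; rewrite [in X in _ *+ X]eN.
by case: n {eN} => [|n] /=; rewrite ?addn0 ?exprS; ring.
Qed.

Lemma ev2_hom N U x y : (size U <= N.+1)%N -> x != 0 ->
  x ^+ N * ev2 (hom N U) x^-1 y = ev2 U x y.
Proof.
move=> sU x0; rewrite [in RHS](poly_coefE sU) /hom !ev2_sum mulr_sumr.
apply: eq_bigr => i _; rewrite -!mul_polyC !ev2M !ev2C !ev2_exp !ev2X mulrCA; congr (_ * _).
rewrite -{1}(subnK (ltn_ord i : (i <= N)%N)) exprD exprVn mulrAC mulfV ?mul1r //.
exact: expf_neq0.
Qed.

Lemma size_dy U : (size (dy U) <= size U)%N.
Proof. exact: size_poly. Qed.

(** Reversal turns [X * d/dX] into [theta], so that the bracket is the reversal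
    of [X] times the Jacobian. *)
Lemma bracket_hom a b (B H : {poly {poly K}}) (c : K) : (0 < a + b)%N ->
  (size B <= a.+1)%N -> (size H <= b.+1)%N ->
  B^`() * dy H - dy B * H^`() = c%:P%:P ->
  bracket a b (hom a B) (hom b H) = c%:P%:P * 'X^((a + b).-1).
Proof.
move=> ab sB sH eJ; rewrite /bracket !dy_hom !theta_hom.
have szX (U : {poly {poly K}}) n : (size U <= n.+1)%N -> (size ('X * U^`())%R <= n.+1)%N.
  move=> sU; rewrite mulrC; apply: leq_trans (size_polyMleq _ _) _; rewrite size_polyX addn2 /=.
  case: (eqVneq U 0) => [->|U0]; first by rewrite deriv0 size_poly0.
  exact: leq_trans (lt_size_deriv U0) _.
rewrite -!homM ?szX ?(leq_trans (size_dy _)) //.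
have -> : - hom (a + b) (dy B * ('X * H^`())) = hom (a+b) (- (dy B * ('X * H^`()))).
  by rewrite /hom -sumrN; apply: eq_bigr => i _; rewrite coefN scaleNr.
rewrite -homD.
have -> : 'X * B^`() * dy H + - (dy B * ('X * H^`())) = c%:P *: 'X^1.
  by rewrite -mul_polyC -eJ expr1; ring.
by rewrite hom_monomial // subn1 mul_polyC.
Qed.

End BivariateAlgebra.

(** * The expansion of the second coordinate in powers of a root of the first *)

Section Expansion.
Variable K : fieldType.
Hypothesis charK : [pchar K] =i pred0.
Implicit Types (u v w f z e : {poly {poly K}}).

Lemma natr_neq0 n : (0 < n)%N -> n%:R != 0 :> K.
Proof. by have /pcharf0P -> := charK; rewrite lt0n. Qed.

Lemma deriv0_polyC (p : {poly K}) : p^`() = 0 -> p = (p`_0)%:P.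
Proof.
move=> p0; apply/polyP => -[|i]; rewrite coefC //=.
have := congr1 (fun q : {poly K} => q`_i) p0; rewrite coef_deriv coef0 => /eqP.
by rewrite -mulr_natr mulf_eq0 (negPf (natr_neq0 _)) // orbF => /eqP.
Qed.

Lemma coef0_factor (R : idomainType) (u : {poly R}) : u`_0 = 0 -> exists v : {poly R}, u = 'X * v.
Proof.
rewrite -horner_coef0 => /eqP /factor_theorem[v ->].
by exists v; rewrite subr0 mulrC.
Qed.

Lemma exprD_second u v n :
  exists q, (u + v) ^+ n = u ^+ n + u ^+ n.-1 * v *+ n + v ^+ 2 * q.
Proof.
elim: n => [|n [q IH]]; first by exists 0; rewrite !expr0 mulr0n; ring.
case: n IH => [|n] IH; first by exists 0; rewrite !expr1 expr0; ring.
exists (u ^+ n *+ n.+1 + (u + v) * q).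
rewrite exprS IH /= !exprS [in RHS]mulrSr.
by move: (u ^+ n) => un; ring.
Qed.

(** Newton's iteration, one coefficient at a time. *)
Lemma approximate_root f a L : (0 < a)%N -> f`_0 = 1 ->
  exists z e, z`_0 = 1 /\ z ^+ a = f + 'X^(L.+1) * e.
Proof.
move=> a0 f0; elim: L => [|L [z [e [z0 ez]]]].
  have /coef0_factor[e ee] : (1 - f)`_0 = 0 by rewrite coefB f0 coef1 subrr.
  by exists 1, e; rewrite coef1 expr1n expr1 -ee; split => //; ring.
(* the correction that cancels the coefficient of order [L.+1] of the error *)
pose w : {poly {poly K}} := (- (a%:R^-1 *: e`_0))%:P.
have [q eq] := exprD_second z ('X^(L.+1) * w) a.
have /coef0_factor[e1 ee1] : (e + z ^+ a.-1 * w *+ a)`_0 = 0.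
  rewrite -horner_coef0 hornerD hornerMn hornerM horner_exp !horner_coef0 z0.
  rewrite expr1n mul1r /w coefC /= mulNrn scalerMnl -mulr_natr mulVf ?natr_neq0 //.
  by rewrite scale1r subrr.
exists (z + 'X^(L.+1) * w), (e1 + 'X^L * w ^+ 2 * q); split.
  by rewrite -horner_coef0 hornerD hornerM hornerXn expr0n mul0r addr0 horner_coef0.
rewrite eq ez.
have -> : f + 'X^(L.+2) * (e1 + 'X^L * w ^+ 2 * q) =
          f + 'X^(L.+1) * ('X * e1) + ('X^(L.+1) * w) ^+ 2 * q.
  by rewrite !exprS; ring.
by rewrite -ee1; ring.
Qed.

Section Step.
Variables (f z e w : {poly {poly K}}) (a N L : nat) (c : K).
Hypotheses (a0 : (0 < a)%N) (N0 : (0 < N)%N) (leNL : (N <= L)%N).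
Hypotheses (z0 : z`_0 = 1) (ez : z ^+ a = f + 'X^L * e) (f0 : f`_0 = 1).
Hypothesis (brw : bracket a N f w = c%:P%:P * 'X^(N.-1) * f).

(** The known terms have zero bracket with [z ^ a], which is [f] up to high
    order: the first unknown coefficient is thus read off the bracket. *)
Lemma next_coefficient l (p : nat -> K) v : (l <= N.-1)%N ->
  w = \sum_(j < l) (p j)%:P%:P * ('X^j * z ^+ (N - j)) + 'X^l * v ->
  (v`_0)^`() *+ a = if l == N.-1 then c%:P else 0.
Proof.
move=> lel ew.
have [w1 ew1] := bracket_Xnl a N L e w.
have e1 : bracket a N (z ^+ a) w = c%:P%:P * 'X^(N.-1) * f + 'X^L * w1.
  by rewrite ez bracketDl brw ew1.
pose br := theta a (z ^+ a) * dy v - dy (z ^+ a) * (theta N v - v *+ l).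
have e2 : bracket a N (z ^+ a) w = 'X^l * br.
  rewrite ew bracketDr bracket_sumr big1 ?add0r => [|j _].
    by rewrite /bracket thetaXn dyM dyXn /br; ring.
  by rewrite bracketCr bracket_powers ?mulr0 //; have := ltn_ord j; lia.
have : br = 'X^(N.-1 - l) * (c%:P%:P * f) + 'X^(L - l) * w1.
  apply: (mulfI (monic_neq0 (monicXn {poly K} l))).
  rewrite -e2 e1 mulrDr !mulrA -!exprD !subnKC //; last by lia.
  by congr (_ + _); ring.
move=> /(congr1 (horner^~ 0)).
have ev0 u : u`_0 = u.[0] by rewrite horner_coef0.
have dz : (dy (z ^+ a)).[0] = 0.
  by rewrite -ev0 coef_dy ev0 horner_exp -ev0 z0 expr1n derivC.
have tz : (theta a (z ^+ a)).[0] = 1 *+ a.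
  by rewrite /theta hornerD hornerN hornerM hornerX mul0r subr0 hornerMn horner_exp -ev0 z0 expr1n.
rewrite /br hornerD hornerN !hornerM tz dz mul0r subr0 -(ev0 (dy v)) coef_dy mulr_natl => ->.
rewrite hornerD !hornerM !hornerXn hornerC -(ev0 f) f0 mulr1.
have /negPf Ll : (L - l != 0)%N by lia.
rewrite !expr0n Ll mul0r addr0.
have -> : (N.-1 - l == 0)%N = (l == N.-1) by lia.
by case: eqP; rewrite ?mul1r ?mul0r.
Qed.

Lemma expansion_upto l : (l <= N.-1)%N -> exists (p : nat -> K) v,
  w = \sum_(j < l) (p j)%:P%:P * ('X^j * z ^+ (N - j)) + 'X^l * v.
Proof.
elim: l => [|l IH] lel.
  by exists (fun=> 0), w; rewrite big_ord0 expr0; ring.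
have [p [v ew]] := IH (ltnW lel).
have := next_coefficient (ltnW lel) ew; rewrite ltn_eqF // => /eqP.
rewrite -mulr_natr mulf_eq0 -polyC_natr polyC_eq0 (negPf (natr_neq0 a0)) orbF.
move=> /eqP /deriv0_polyC v0; set q := (v`_0)`_0 in v0.
have /coef0_factor[v1 ev1] : (v - q%:P%:P * z ^+ (N - l))`_0 = 0.
  by rewrite -horner_coef0 hornerD hornerN hornerM hornerC horner_exp !horner_coef0 z0 v0
     expr1n mulr1 subrr.
exists (fun j => if j == l then q else p j), v1.
rewrite big_ord_recr /= eqxx ew -addrA; congr (_ + _).
  by apply: eq_bigr => j _; rewrite ltn_eqF.
have -> : v = q%:P%:P * z ^+ (N - l) + 'X * v1 by rewrite -ev1; ring.
by rewrite exprSr; ring.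
Qed.

(** At order [N.-1] the bracket sees the Jacobian constant, so the coefficient is
    affine in [y] instead of constant. *)
Lemma expansion_last : exists (p : nat -> K) (q : K) v,
  w = \sum_(j < N.-1) (p j)%:P%:P * ('X^j * z ^+ (N - j))
      + 'X^(N.-1) * ((c / a%:R)%:P * 'X + q%:P)%:P + 'X^N * v.
Proof.
have [p [v ew]] := expansion_upto (leqnn _).
have := next_coefficient (leqnn _) ew; rewrite eqxx => dv.
have /deriv0_polyC : (v`_0 - (c / a%:R)%:P * 'X)^`() = 0.
  rewrite derivB derivM derivC derivX mul0r add0r mulr1; apply/eqP; rewrite subr_eq0.
  apply/eqP/(mulIf (_ : a%:R != 0)); last first.
    by rewrite mulr_natr dv -polyC_natr -polyCM mulfVK ?natr_neq0.
  by rewrite -polyC_natr polyC_eq0 natr_neq0.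
set q : K := (v`_0 - (c / a%:R)%:P * 'X)`_0 => ev0.
have ev0' : v`_0 = (c / a%:R)%:P * 'X + q%:P by rewrite -ev0; ring.
have /coef0_factor[v1 ev1] : (v - (v`_0)%:P)`_0 = 0.
  by rewrite coefB coefC subrr.
exists p, q, v1; rewrite {1}ew -addrA; congr (_ + _); rewrite -ev0'.
have {1}-> : v = (v`_0)%:P + 'X * v1 by rewrite -ev1; ring.
by rewrite -{3}(prednK N0) exprSr; ring.
Qed.

End Step.

(** In terms of [t = 1 / X], the polynomial [B] has an [a]-th root
    [Z = X + z (t, y)] up to a high power of [t].  The Jacobian condition says
    that in the coordinates [(Z, y)] the derivative of [H] in [y] is
    [c / (a * Z ^ (a - 1)) * dX/dZ], so that the coefficients of the expansion
    of [H] in powers of [Z] do not depend on [y] until that order. *)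
Lemma asymptotic_expansion a (B H : {poly {poly K}}) (c : K) :
  (0 < a)%N -> B \is monic -> size B = a.+1 ->
  B^`() * dy H - dy B * H^`() = c%:P%:P ->
  exists N (P : {poly K}) (z e r : {poly {poly K}}), (size P <= N.+1)%N /\
    forall X y : K, X != 0 -> let Z := X + ev2 z X^-1 y in
      Z ^+ a = ev2 B X y + X^-1 ^+ (1 + a * N) * ev2 e X^-1 y /\
      ev2 B X y * ev2 H X y = P.[Z] + c / a%:R * (X * y) + ev2 r X^-1 y.
Proof.
move=> a0 monB sB eJ; pose b := size H; pose N := (a + b)%N.
have N0 : (0 < N)%N by rewrite /N addn_gt0 a0.
have sH : (size H <= b.+1)%N by [].
have sB' : (size B <= a.+1)%N by rewrite sB.
pose f := hom a B; pose g := hom b H.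
have f0 : f`_0 = 1.
  by rewrite /f coef0_hom; have /monicP := monB; rewrite lead_coefE sB.
(* the error [t ^ L.+1] of the root is divided by [t ^ a] in terms of [Z] *)
pose L := (a + a * N)%N.
have [z [e [z0 ez]]] := approximate_root L a0 f0.
have brw : bracket a N f (f * g) = c%:P%:P * 'X^(N.-1) * f.
  by rewrite bracket_selfM (bracket_hom _ _ _ eJ) // mulrC.
have leNL : (N <= L.+1)%N.
  by rewrite /L; apply: leqW; apply: leq_trans (leq_addl _ _); rewrite leq_pmull.
have [p [q [v ew]]] := expansion_last a0 N0 leNL z0 ez f0 brw.
have /coef0_factor[z1 ez1] : (z - 1)`_0 = 0 by rewrite coefB coef1 z0 subrr.
have {}ez1 : z = 1 + 'X * z1 by rewrite -ez1; ring.
(* the term [q * X] left by the last step is [q * Z - q * z1] *)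
exists N, (\sum_(j < N.-1) p j *: 'X^(N - j) + q *: 'X), z1, e, (v - q%:P%:P * z1).
split.
  apply: leq_trans (size_polyD _ _) _; rewrite geq_max; apply/andP; split.
    apply: leq_trans (size_sum _ _ _) _; apply/bigmax_leqP => j _.
    by apply: leq_trans (size_scale_leq _ _) _; rewrite size_polyXn ltnS leq_subr.
  by apply: leq_trans (size_scale_leq _ _) _; rewrite size_polyX.
move=> X y X0; set t := X^-1; cbv zeta.
have eZ : X + ev2 z1 t y = X * ev2 z t y.
  by rewrite ez1 ev2D ev2M ev2X -polyC1 ev2C hornerC mulrDr mulr1 mulrA mulfV ?mul1r.
rewrite eZ; split.
  rewrite exprMn -ev2_exp ez ev2D mulrDr /f ev2_hom // ev2M ev2_exp ev2X mulrA.
  congr (_ + _ * _); rewrite /L -addnS exprD mulrA -exprMn mulfV // expr1n mul1r.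
  by rewrite add1n.
have -> : ev2 B X y * ev2 H X y = X ^+ N * ev2 (f * g) t y.
  by rewrite /f /g -homM // ev2_hom ?ev2M // (leq_trans (size_polyMleq _ _)) // sB /= leqW.
have XtN j : (j <= N)%N -> X ^+ N * t ^+ j = X ^+ (N - j).
  by move=> lejN; rewrite -{1}(subnK lejN) exprD -mulrA -exprMn mulfV // expr1n mulr1.
rewrite ew !ev2D !mulrDr ev2_sum hornerD horner_sum mulr_sumr.
have -> : \sum_(j < N.-1) X ^+ N * ev2 ((p j)%:P%:P * ('X^j * z ^+ (N - j))) t y =
  \sum_(j < N.-1) (p j *: 'X^(N - j)).[X * ev2 z t y].
  apply: eq_bigr => j _; rewrite !ev2M !ev2_exp ev2X ev2C hornerC hornerZ hornerXn exprMn.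
  by rewrite -XtN; [ring | have := ltn_ord j; lia].
rewrite -!addrA; congr (_ + _).
rewrite ev2N !ev2M !ev2_exp !ev2X !ev2C !(mulrA (X ^+ N)) !XtN ?leq_pred // subnn expr0.
have -> : (N - N.-1 = 1)%N by lia.
rewrite hornerZ hornerD hornerM !hornerX !hornerC expr1.
rewrite -eZ; ring.
Qed.

End Expansion.

(** * Orders of growth *)

Lemma ler_expz (K : numFieldType) (x : K) (l m : int) : 1 <= x -> l <= m -> x ^ l <= x ^ m.
Proof.
move=> x1 lm; have x0 := lt_le_trans ltr01 x1.
rewrite -(subrK l m) expfzDr ?gt_eqF //; have : 0 <= m - l by rewrite subr_ge0.
case: (m - l) => // n _; rewrite -exprnP ler_peMl ?exprn_ege1 //.
by rewrite ltW ?exprz_gt0.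
Qed.

Section Growth.
Variables (K : numFieldType) (T : Type) (D : T -> Prop) (Y : T -> K).
Implicit Types (s u v : T -> K) (l m k : int).

(** The gauge [Y] measures how far a point of [D] is from the origin; the lower
    bound [1 <= M] makes [Y p] a positive real number. *)
Definition eventually (P : T -> Prop) : Prop :=
  exists M : K, 1 <= M /\ forall p, D p -> M <= Y p -> P p.

Definition bigO l s := exists C : K,
  0 <= C /\ eventually (fun p => `|s p| <= C * Y p ^ l).

Definition bigOmega l s := exists d : K,
  0 < d /\ eventually (fun p => d * Y p ^ l <= `|s p|).

Lemma eventually_imp (P Q : T -> Prop) :
  eventually P -> (forall p, D p -> 1 <= Y p -> P p -> Q p) -> eventually Q.
Proof.
move=> [M [M1 HP]] PQ; exists M; split=> // p Dp MY.
by apply: PQ => //; [apply: le_trans MY | apply: HP].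
Qed.

Lemma eventually_imp2 (P Q R : T -> Prop) : eventually P -> eventually Q ->
  (forall p, D p -> 1 <= Y p -> P p -> Q p -> R p) -> eventually R.
Proof.
move=> [M [M1 HP]] [N [N1 HQ]] PQR.
have N0 := le_trans ler01 N1; have M0 := le_trans ler01 M1.
exists (M + N); split=> [|p Dp MNY]; first by rewrite (le_trans M1) // lerDl.
have MY : M <= Y p by apply: le_trans MNY; rewrite lerDl.
have NY : N <= Y p by apply: le_trans MNY; rewrite lerDr.
by apply: PQR => //; [apply: le_trans MY | apply: HP | apply: HQ].
Qed.

Lemma eventually_and (P Q : T -> Prop) :
  eventually P -> eventually Q -> eventually (fun p => P p /\ Q p).
Proof. by move=> EP EQ; apply: eventually_imp2 EP EQ _. Qed.

Lemma eventually_ge (M : K) : 0 <= M -> eventually (fun p => M <= Y p).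
Proof.
move=> M0; exists (1 + M); split=> [|p _]; first by rewrite lerDl.
by move=> H; apply: le_trans H; rewrite lerDr ler01.
Qed.

Lemma eventually_all (P : T -> Prop) : (forall p, D p -> P p) -> eventually P.
Proof. by move=> HP; exists 1; split=> // p Dp _; apply: HP. Qed.

Lemma bigO_weaken l m s : l <= m -> bigO l s -> bigO m s.
Proof.
move=> lm [C [C0 Os]]; exists C; split=> //; apply: eventually_imp Os _ => p _ Y1 le_s.
by apply: le_trans le_s _; apply: ler_wpM2l => //; exact: ler_expz.
Qed.

Lemma bigO_ext l s u : bigO l s -> eventually (fun p => s p = u p) -> bigO l u.
Proof.
by move=> [C [C0 Os]] su; exists C; split=> //; apply: eventually_imp2 Os su _ => p _ _ le_s <-.
Qed.

Lemma bigO_eq l s u : bigO l s -> (forall p, D p -> s p = u p) -> bigO l u.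
Proof. by move=> Os su; apply: bigO_ext Os _; exact: eventually_all. Qed.

Lemma bigOD l s u : bigO l s -> bigO l u -> bigO l (fun p => s p + u p).
Proof.
move=> [C [C0 Os]] [E [E0 Ou]]; exists (C + E); split; first exact: addr_ge0.
apply: eventually_imp2 Os Ou _ => p _ _ le_s le_u.
by rewrite mulrDl (le_trans (ler_normD _ _)) // lerD.
Qed.

Lemma bigON l s : bigO l s -> bigO l (fun p => - s p).
Proof.
move=> [C [C0 Os]]; exists C; split=> //.
by apply: eventually_imp Os _ => p _ _; rewrite normrN.
Qed.

Lemma bigOB l s u : bigO l s -> bigO l u -> bigO l (fun p => s p - u p).
Proof. by move=> Os Ou; apply: bigOD Os _; exact: bigON. Qed.

Lemma bigOM l m s u : bigO l s -> bigO m u -> bigO (l + m) (fun p => s p * u p).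
Proof.
move=> [C [C0 Os]] [E [E0 Ou]]; exists (C * E); split; first exact: mulr_ge0.
apply: eventually_imp2 Os Ou _ => p _ Y1 le_s le_u.
rewrite normrM expfzDr ?gt_eqF ?(lt_le_trans ltr01) //.
by rewrite mulrACA ler_pM.
Qed.

Lemma bigO_cst (c : K) : bigO 0 (fun=> c).
Proof.
exists `|c|; split=> //; apply: eventually_all => p _.
by rewrite expr0z mulr1.
Qed.

Lemma bigO_scale (c : K) l s : bigO l s -> bigO l (fun p => c * s p).
Proof. by move=> Os; have := bigOM (bigO_cst c) Os; rewrite add0r. Qed.

Lemma bigOX l s n : bigO l s -> bigO (l * n%:Z) (fun p => s p ^+ n).
Proof.
move=> Os; elim: n => [|n IH]; first by rewrite mulr0; apply: bigO_eq (bigO_cst 1) _.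
rewrite -addn1 PoszD mulrDr mulr1 addrC.
by apply: bigO_eq (bigOM Os IH) _ => p _; rewrite addn1 exprS.
Qed.

Lemma bigO0 l : bigO l (fun=> 0).
Proof. by exists 0; split=> //; apply: eventually_all => p _; rewrite normr0 mul0r. Qed.

Lemma bigO_sum l n (f : nat -> T -> K) : (forall i, (i < n)%N -> bigO l (f i)) ->
  bigO l (fun p => \sum_(i < n) f i p).
Proof.
elim: n => [|n IH] Of; first by apply: bigO_eq (bigO0 l) _ => p _; rewrite big_ord0.
have On : bigO l (fun p => \sum_(i < n) f i p) by apply: IH => i lin; apply: Of; lia.
by apply: bigO_eq (bigOD On (Of n (ltnSn n))) _ => p _; rewrite big_ord_recr.
Qed.

Lemma bigO_horner k N (P : {poly K}) s : 0 <= k -> (size P <= N.+1)%N ->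
  bigO k s -> bigO (k * N%:Z) (fun p => P.[s p]).
Proof.
move=> k0 sP Os.
have Of i : (i < N.+1)%N -> bigO (k * N%:Z) (fun p => P`_i * s p ^+ i).
  by move=> lti; apply/bigO_scale/(bigO_weaken _ (bigOX i Os)); rewrite ler_wpM2l // lez_nat.
apply: bigO_eq (bigO_sum Of) _ => p _.
by rewrite (horner_coef_wide _ sP).
Qed.

(** An exponent of growth in the inner variable, independent of the gauge. *)
Definition ydeg (U : {poly {poly K}}) : nat := \max_(i < size U) size (U`_i)%R.

Lemma size_ydeg (U : {poly {poly K}}) i : (size (U`_i)%R <= (ydeg U).+1)%N.
Proof.
case: (ltnP i (size U)) => [lti|/(nth_default 0) ->]; last by rewrite size_poly0.
by apply: leqW; rewrite /ydeg (leq_bigmax (Ordinal lti)).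
Qed.

Lemma ev2_coef N (U : {poly {poly K}}) x y : (size U <= N.+1)%N ->
  ev2 U x y = \sum_(i < N.+1) (U`_i).[y] * x ^+ i.
Proof.
move=> sU; rewrite {1}(poly_coefE sU) ev2_sum; apply: eq_bigr => i _.
by rewrite -mul_polyC ev2M ev2C ev2_exp ev2X.
Qed.

Lemma bigO_ev2 k N (U : {poly {poly K}}) s u : 0 <= k -> (size U <= N.+1)%N ->
  bigO k s -> bigO 1 u -> bigO ((ydeg U)%:Z + k * N%:Z) (fun p => ev2 U (s p) (u p)).
Proof.
move=> k0 sU Os Ou.
have Of i : (i < N.+1)%N ->
    bigO ((ydeg U)%:Z + k * N%:Z) (fun p => (U`_i).[u p] * s p ^+ i).
  move=> lti; apply: bigOM; last first.
    by apply: bigO_weaken (bigOX i Os); rewrite ler_wpM2l // lez_nat.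
  by have := bigO_horner ler01 (size_ydeg U i) Ou; rewrite mul1r.
apply: bigO_eq (bigO_sum Of) _ => p _.
by rewrite -ev2_coef.
Qed.

Lemma bigO_ev2_0 (U : {poly {poly K}}) s u : bigO 0 s -> bigO 1 u ->
  bigO (ydeg U)%:Z (fun p => ev2 U (s p) (u p)).
Proof.
by move=> Os Ou; have := bigO_ev2 (lexx 0) (leqnSn (size U)) Os Ou; rewrite mul0r addr0.
Qed.

Lemma bigO_geometric k s u n : bigO k s -> bigO k u ->
  bigO (k * n.-1%:Z) (fun p => \sum_(i < n) s p ^+ (n.-1 - i) * u p ^+ i).
Proof.
move=> Os Ou.
apply: (bigO_sum (f := fun i p => s p ^+ (n.-1 - i) * u p ^+ i)).
move=> i lti; have := bigOM (bigOX (n.-1 - i) Os) (bigOX i Ou).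
by rewrite -mulrDr -PoszD subnK //; lia.
Qed.

Lemma bigO_expB k l s u n : bigO k s -> bigO k u ->
  bigO l (fun p => s p - u p) ->
  bigO (l + k * n.-1%:Z) (fun p => s p ^+ n - u p ^+ n).
Proof.
move=> Os Ou Osu; apply: bigO_eq (bigOM Osu (bigO_geometric n Os Ou)) _ => p _.
by rewrite subrXX.
Qed.

Definition divided_difference (P : {poly K}) (x y : K) : K :=
  \sum_(i < size P) P`_i * \sum_(j < i) x ^+ (i.-1 - j) * y ^+ j.

Lemma divided_differenceP P x y :
  P.[x] - P.[y] = (x - y) * divided_difference P x y.
Proof.
rewrite !horner_coef -sumrB mulr_sumr; apply: eq_bigr => i _.
by rewrite -mulrBr subrXX mulrCA.
Qed.

Lemma bigO_divided_difference k N (P : {poly K}) s u : 0 <= k ->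
  (size P <= N.+1)%N -> bigO k s -> bigO k u ->
  bigO (k * N%:Z) (fun p => divided_difference P (s p) (u p)).
Proof.
move=> k0 sP Os Ou.
apply: (bigO_sum (f := fun i p => P`_i * \sum_(j < i) s p ^+ (i.-1 - j) * u p ^+ j)).
move=> i lti; apply/bigO_scale/(bigO_weaken _ (bigO_geometric i Os Ou)).
by rewrite ler_wpM2l // lez_nat; lia.
Qed.

Lemma ev2_divided_difference (U : {poly {poly K}}) s1 s2 u1 u2 :
  bigO 0 s1 -> bigO 0 s2 -> bigO 1 u1 -> bigO 1 u2 ->
  exists A B, [/\ bigO (ydeg U)%:Z A, bigO (ydeg U)%:Z B &
    forall p, ev2 U (s1 p) (u1 p) - ev2 U (s2 p) (u2 p) =
              (s1 p - s2 p) * A p + (u1 p - u2 p) * B p].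
Proof.
move=> Os1 Os2 Ou1 Ou2; have sU := leqnSn (size U).
pose A p := \sum_(i < (size U).+1)
  (U`_i).[u2 p] * \sum_(j < i) s1 p ^+ (i.-1 - j) * s2 p ^+ j.
pose B p := \sum_(i < (size U).+1) divided_difference U`_i (u1 p) (u2 p) * s1 p ^+ i.
exists A, B; split.
- apply: (bigO_sum (f := fun i p =>
    (U`_i).[u2 p] * \sum_(j < i) s1 p ^+ (i.-1 - j) * s2 p ^+ j)) => i _.
  rewrite -[(ydeg U)%:Z]addr0; apply: bigOM.
    by have := bigO_horner ler01 (size_ydeg U i) Ou2; rewrite mul1r.
  by have := bigO_geometric i Os1 Os2; rewrite mul0r.
- apply: (bigO_sum (f := fun i p =>
    divided_difference U`_i (u1 p) (u2 p) * s1 p ^+ i)) => i _.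
  rewrite -[(ydeg U)%:Z]addr0; apply: bigOM.
    by have := bigO_divided_difference ler01 (size_ydeg U i) Ou1 Ou2; rewrite mul1r.
  by have := bigOX i Os1; rewrite mul0r.
move=> p; rewrite !(ev2_coef _ _ sU) -sumrB !mulr_sumr -big_split; apply: eq_bigr => i _ /=.
by rewrite mulrCA -subrXX mulrA -divided_differenceP; ring.
Qed.

Lemma bigOmega_O l m s u : l < m -> bigOmega m s -> bigO l u ->
  bigOmega m (fun p => s p + u p).
Proof.
move=> lm [d [d0 Os]] [C [C0 Ou]]; exists (d / 2); split; first exact: divr_gt0.
have M0 : 0 <= C / (d / 2) by rewrite divr_ge0 // divr_ge0 // ltW.
have Y2 := eventually_and Ou (eventually_ge M0).
apply: eventually_imp2 Os Y2 _ => p Dp Y1 le_s [le_u geM].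
have Y0 : 0 < Y p := lt_le_trans ltr01 Y1.
have le_u2 : `|u p| <= d / 2 * Y p ^ m.
  apply: le_trans le_u _.
  have [e [e0 ->]] : exists e : int, 0 <= e /\ m = e + 1 + l by exists (m - 1 - l); lia.
  rewrite !expfzDr ?gt_eqF // expr1z mulrA ler_pM2r ?exprz_gt0 //.
  have le1 : 1 <= Y p ^ e.
    by rewrite -(expr0z (Y p)); apply: ler_expz.
  have d2 : 0 < d / 2 by rewrite divr_gt0.
  rewrite ler_pdivrMr // mulrC in geM; apply: le_trans geM _.
  by rewrite ler_pM2l // ler_peMl // ltW.
rewrite -[u p]opprK; apply: (le_trans _ (lerB_dist _ _)); rewrite normrN.
rewrite lerBrDr; apply: le_trans le_s; rewrite {2}(splitr d) mulrDl.
by rewrite lerD2l.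
Qed.

Lemma bigOmega_ext l s u :
  bigOmega l s -> eventually (fun p => s p = u p) -> bigOmega l u.
Proof.
by move=> [C [C0 Os]] su; exists C; split=> //; apply: eventually_imp2 Os su _ => p _ _ le_s <-.
Qed.

Lemma bigOmega_perturb l m s u : l < m -> bigOmega m s ->
  bigO l (fun p => u p - s p) -> bigOmega m u.
Proof.
move=> lm Os Osu; apply: bigOmega_ext (bigOmega_O lm Os Osu) _.
by apply: eventually_all => p _; rewrite addrC subrK.
Qed.

Lemma bigOmegaM l m s u : bigOmega l s -> bigOmega m u ->
  bigOmega (l + m) (fun p => s p * u p).
Proof.
move=> [C [C0 Os]] [E [E0 Ou]]; exists (C * E); split; first exact: mulr_gt0.
apply: eventually_imp2 Os Ou _ => p _ Y1 le_s le_u.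
have Y0 : 0 < Y p := lt_le_trans ltr01 Y1.
rewrite normrM expfzDr ?gt_eqF // mulrACA ler_pM // mulr_ge0 ?(ltW C0) ?(ltW E0) //.
  by rewrite ltW ?exprz_gt0.
by rewrite ltW ?exprz_gt0.
Qed.

Lemma bigOmega_cst (c : K) : c != 0 -> bigOmega 0 (fun=> c).
Proof.
move=> c0; exists `|c|; rewrite normr_gt0; split=> //; apply: eventually_all => p _.
by rewrite expr0z mulr1.
Qed.

Lemma bigOmega_scale (c : K) l s : c != 0 -> bigOmega l s -> bigOmega l (fun p => c * s p).
Proof. by move=> c0 Os; have := bigOmegaM (bigOmega_cst c0) Os; rewrite add0r. Qed.

Lemma bigOmegaX l s n : bigOmega l s -> bigOmega (l * n%:Z) (fun p => s p ^+ n).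
Proof.
move=> Os; elim: n => [|n IH].
  rewrite mulr0; apply: bigOmega_ext (bigOmega_cst (oner_neq0 _)) _.
  exact: eventually_all.
rewrite -addn1 PoszD mulrDr mulr1 addrC; apply: bigOmega_ext (bigOmegaM Os IH) _.
by apply: eventually_all => p _; rewrite addn1 exprS.
Qed.

(** A lower bound on a power and an upper bound on its base give a lower bound on
    the base, without extracting roots. *)
Lemma bigOmega_root l s n : (0 < n)%N ->
  bigO l s -> bigOmega (l * n%:Z) (fun p => s p ^+ n) -> bigOmega l s.
Proof.
case: n => // n _ Os [d [d0 Osn]]; have [C [C0 OC]] := bigOX n Os.
have C1 : 0 < C + 1 by rewrite ltr_wpDl.
exists (d / (C + 1)); split; first by rewrite divr_gt0.
apply: eventually_imp2 Osn OC _ => p Dp Y1 ge_s le_s.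
have Y0 : 0 < Y p := lt_le_trans ltr01 Y1.
have {}le_s : `|s p ^+ n| <= (C + 1) * Y p ^ (l * n%:Z).
  by apply: le_trans le_s _; rewrite ler_pM2r ?exprz_gt0 // lerDl.
rewrite mulrAC ler_pdivrMr // -(ler_pM2r (exprz_gt0 (l * n%:Z) Y0)).
rewrite -!mulrA -expfzDr ?gt_eqF // [X in Y p ^ X](_ : _ = l * n.+1%:Z); last first.
  by rewrite -addn1 PoszD; ring.
by apply: le_trans ge_s _; rewrite exprS normrM ler_wpM2l.
Qed.

Lemma bigOmega_neq0 l s : bigOmega l s -> eventually (fun p => s p != 0).
Proof.
move=> [d [d0 Os]]; apply: eventually_imp Os _ => p _ Y1; rewrite -normr_gt0.
by move=> H; apply: lt_le_trans H; rewrite mulr_gt0 // exprz_gt0 // (lt_le_trans ltr01).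
Qed.

Lemma bigO_inv l s : bigOmega l s -> bigO (- l) (fun p => (s p)^-1).
Proof.
move=> Os; have s0 := bigOmega_neq0 Os; have [d [d0 Os']] := Os.
exists d^-1; split; first by rewrite invr_ge0 ltW.
apply: eventually_imp2 Os' s0 _ => p _ Y1 ge_s sp0.
have Y0 : 0 < Y p := lt_le_trans ltr01 Y1.
rewrite normfV -invr_expz -invfM lef_pV2 ?qualifE /= ?normr_gt0 ?mulr_gt0 ?exprz_gt0 //.
Qed.

Lemma bigOmega_horner k n (P : {poly K}) s : 0 < k -> size P = n.+1 ->
  bigO k s -> bigOmega k s -> bigOmega (k * n%:Z) (fun p => P.[s p]).
Proof.
move=> k0 sP Os Os'.
have c0 : lead_coef P != 0 by rewrite lead_coef_eq0 -size_poly_eq0 sP.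
have Om := bigOmega_scale c0 (bigOmegaX n Os').
case: n sP Om => [|n] sP Om.
  apply: bigOmega_ext Om _; apply: eventually_all => p _.
  have /size1_polyC eP : (size P <= 1)%N by rewrite sP.
  by rewrite eP lead_coefC hornerC expr0 mulr1.
apply: (bigOmega_perturb (l := k * n%:Z)) Om _; first by rewrite -addn1 PoszD; lia.
have sQ : (size (P - lead_coef P *: 'X^(n.+1))%R <= n.+1)%N.
  apply/leq_sizeP => j; rewrite leq_eqVlt => /predU1P[<-|lt].
    by rewrite coefB coefZ coefXn eqxx mulr1 lead_coefE sP subrr.
  by rewrite coefB coefZ coefXn gtn_eqF // mulr0 subr0 nth_default // sP.
apply: bigO_eq (bigO_horner (ltW k0) sQ Os) _ => p _.
by rewrite hornerD hornerN hornerZ hornerXn.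
Qed.

(** The contradiction that closes each case of the analysis of double points. *)
Lemma bigOmega_bigO_bounded l m s : l < m -> bigOmega m s -> bigO l s ->
  eventually (fun=> False).
Proof.
move=> lm Os Os'; have := bigOmega_O lm Os (bigON Os').
move=> /bigOmega_neq0 E; apply: eventually_imp E _ => p _ _.
by rewrite subrr eqxx.
Qed.

End Growth.

(** * Size of the coordinates at a double point *)

Lemma eventually_sub (K : numFieldType) (T : Type) (D D' : T -> Prop) (Y : T -> K)
    (P : T -> Prop) :
  (forall p, D' p -> D p) -> eventually D Y P -> eventually D' Y P.
Proof. by move=> sub [M [M1 HP]]; exists M; split=> // p /sub; apply: HP. Qed.

Section Halving.
Variables (K : numFieldType) (T : Type) (D : T -> Prop) (Y y1 y2 : T -> K).
Hypothesis hY : forall p, D p -> Y p = `|y1 p| + `|y2 p|.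
Local Notation O := (bigO D Y).
Local Notation Om := (bigOmega D Y).

Lemma exprD_le (u v : K) n : 0 <= u -> 0 <= v ->
  (u + v) ^+ n <= 2 ^+ n * (u ^+ n + v ^+ n).
Proof.
move=> u0 v0; have dbl (w : K) : w + w = 2 * w by ring.
have [uv|vu] := real_leP (ger0_real u0) (ger0_real v0).
  apply: le_trans (_ : (2 * v) ^+ n <= _).
    by rewrite lerXn2r ?nnegrE ?addr_ge0 ?mulr_ge0 // -dbl lerD2r.
  by rewrite exprMn ler_wpM2l ?exprn_ge0 // lerDr exprn_ge0.
apply: le_trans (_ : (2 * u) ^+ n <= _).
  by rewrite lerXn2r ?nnegrE ?addr_ge0 ?mulr_ge0 // -dbl lerD2l ltW.
by rewrite exprMn ler_wpM2l ?exprn_ge0 // lerDl exprn_ge0.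
Qed.

(** The larger of [|y1|] and [|y2|] is at least [Y / 2], and the two powers have
    almost the same modulus. *)
Lemma bigOmega_half n : O (n%:Z - 1) (fun p => y1 p ^+ n - y2 p ^+ n) ->
  Om n%:Z (fun p => y1 p ^+ n).
Proof.
move=> Ody.
have Oms : Om n%:Z (fun p => `|y1 p| ^+ n + `|y2 p| ^+ n).
  exists (2 ^- n); split; first by rewrite invr_gt0 exprn_gt0.
  apply: eventually_all => p Dp; rewrite ger0_norm ?addr_ge0 ?exprn_ge0 //.
  by rewrite hY // -exprnP mulrC ler_pdivrMr ?exprn_gt0 // mulrC exprD_le.
have Od : O (n%:Z - 1) (fun p => `|y1 p| ^+ n - `|y2 p| ^+ n).
  have [C [C0 OC]] := Ody; exists C; split=> //; apply: eventually_imp OC _ => p _ _.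
  by apply: le_trans; rewrite -!normrX ler_dist_dist.
have lt1 : n%:Z - 1 < n%:Z by lia.
have [d [d0 Hd]] := bigOmega_O lt1 Oms Od.
exists (d / 2); split; first by rewrite divr_gt0.
apply: eventually_imp Hd _ => p _ _.
have -> : `|y1 p| ^+ n + `|y2 p| ^+ n + (`|y1 p| ^+ n - `|y2 p| ^+ n) = 2 * `|y1 p ^+ n|.
  by rewrite normrX; ring.
rewrite normrM normr_id ger0_norm // mulrAC ler_pdivrMr //.
by rewrite [2 * _]mulrC.
Qed.

End Halving.

(** [c] is the constant of the Jacobian divided by [a].  The family [D] stays
    abstract because each root of unity will require a subfamily. *)
Section Coincidences.
Variables (K : numClosedFieldType) (B H : {poly {poly K}}) (a N K0 : nat).
Variables (c : K) (P : {poly K}) (z e r : {poly {poly K}}).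
Hypotheses (a0 : (0 < a)%N) (monB : B \is monic) (sB : size B = a.+1) (c0 : c != 0).
Hypotheses (sP : (size P <= N.+1)%N).
Hypothesis expansion : forall X y : K, X != 0 -> let Z := X + ev2 z X^-1 y in
  Z ^+ a = ev2 B X y + X^-1 ^+ (1 + a * N) * ev2 e X^-1 y /\
  ev2 B X y * ev2 H X y = P.[Z] + c * (X * y) + ev2 r X^-1 y.
Hypotheses (dB : (ydeg (B - 'X^a) <= K0)%N) (dz : (ydeg z <= K0)%N).
Hypotheses (de : (ydeg e <= K0)%N) (dr : (ydeg r <= K0)%N).
Let k := (a * (K0 + 2))%N.

Variables (T : Type) (D : T -> Prop) (Y X1 y1 X2 y2 : T -> K).
Local Notation O := (bigO D Y).
Local Notation Om := (bigOmega D Y).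
Local Notation ev := (eventually D Y).
Hypothesis hY : forall p, D p -> Y p = `|y1 p| + `|y2 p|.
Hypothesis hX1 : O 1 (fun p => X1 p - y1 p ^+ k).
Hypothesis hX2 : O 1 (fun p => X2 p - y2 p ^+ k).
Hypothesis hB : forall p, D p -> ev2 B (X1 p) (y1 p) = ev2 B (X2 p) (y2 p).
Hypothesis hH : forall p, D p -> ev2 H (X1 p) (y1 p) = ev2 H (X2 p) (y2 p).

Let k_ge : (K0 + 2 <= k)%N. Proof. by rewrite /k leq_pmull. Qed.

Lemma y1_O : O 1 y1.
Proof.
exists 1; split=> //; apply: eventually_all => p Dp.
by rewrite mul1r expr1z hY // lerDl.
Qed.

Lemma y2_O : O 1 y2.
Proof.
exists 1; split=> //; apply: eventually_all => p Dp.
by rewrite mul1r expr1z hY // lerDr.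
Qed.

Lemma X_O (X y : T -> K) : O 1 y -> O 1 (fun p => X p - y p ^+ k) -> O k%:Z X.
Proof.
move=> Oy OX; have Oyk := bigOX k Oy; rewrite mul1r in Oyk.
have lek : 1 <= k%:Z by lia.
by apply: bigO_eq (bigOD (bigO_weaken lek OX) Oyk) _ => p _; rewrite subrK.
Qed.

Lemma size_B_tail : (size (B - 'X^a)%R <= a.-1.+1)%N.
Proof.
rewrite prednK //; apply/leq_sizeP => j; rewrite leq_eqVlt => /predU1P[<-|lt].
  by rewrite coefB coefXn eqxx; have /monicP := monB; rewrite lead_coefE sB => ->; rewrite subrr.
by rewrite coefB coefXn gtn_eqF // subr0 nth_default // sB.
Qed.

Lemma ev2_B (X y : K) : ev2 B X y = X ^+ a + ev2 (B - 'X^a) X y.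
Proof. by rewrite ev2D ev2N ev2_exp ev2X addrC subrK. Qed.

Lemma degree_pred : a%:Z = a.-1%:Z + 1.
Proof. by lia. Qed.

Lemma tail_O X y : O 1 y -> O k%:Z X ->
  O ((k * a)%N%:Z - 1) (fun p => ev2 (B - 'X^a) (X p) (y p)).
Proof.
move=> Oy OX; have k0 : 0 <= k%:Z by [].
apply: bigO_weaken (bigO_ev2 k0 size_B_tail OX Oy).
rewrite PoszM degree_pred; nia.
Qed.

(** The values of [B] agree, its leading term is [X ^ a], and [X] is close to
    [y ^ k]. *)
Lemma y_power_dist : O ((k * a)%N%:Z - 1) (fun p => y1 p ^+ (k * a) - y2 p ^+ (k * a)).
Proof.
have OX1 := X_O y1_O hX1; have OX2 := X_O y2_O hX2.
have dist X y : O 1 y -> O 1 (fun p => X p - y p ^+ k) ->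
    O ((k * a)%N%:Z - 1) (fun p => X p ^+ a - (y p ^+ k) ^+ a).
  move=> Oy hX; have OX := X_O Oy hX; have Oyk := bigOX k Oy; rewrite mul1r in Oyk.
  apply: bigO_weaken (bigO_expB a OX Oyk hX).
  rewrite PoszM degree_pred; nia.
have := bigOB (bigOB (tail_O y2_O OX2) (tail_O y1_O OX1))
  (bigOB (dist _ _ y1_O hX1) (dist _ _ y2_O hX2)).
move/bigO_eq; apply=> p Dp; have := hB Dp; rewrite !ev2_B !exprM => eB.
have -> : ev2 (B - 'X^a) (X2 p) (y2 p) =
  X1 p ^+ a + ev2 (B - 'X^a) (X1 p) (y1 p) - X2 p ^+ a by rewrite eB; ring.
by ring.
Qed.

Lemma power_Om y : O 1 y -> Om (k * a)%N%:Z (fun p => y p ^+ (k * a)) ->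
  Om k%:Z (fun p => y p ^+ k).
Proof.
move=> Oy Oya; have Oyk := bigOX k Oy; rewrite mul1r in Oyk.
apply: (bigOmega_root a0 Oyk); rewrite -PoszM; apply: bigOmega_ext Oya _.
by apply: eventually_all => p _; rewrite exprM.
Qed.

Lemma X_Om X y : Om k%:Z (fun p => y p ^+ k) -> O 1 (fun p => X p - y p ^+ k) ->
  Om k%:Z X.
Proof. by move=> Oy; apply: bigOmega_perturb Oy; lia. Qed.

Lemma X1_Om : Om k%:Z X1.
Proof.
apply: X_Om hX1; apply: (power_Om y1_O); apply: (bigOmega_half hY).
exact: y_power_dist.
Qed.

Lemma X2_Om : Om k%:Z X2.
Proof.
apply: X_Om hX2; apply: (power_Om y2_O).
apply: (bigOmega_half (y2 := y1)) => [p Dp|]; first by rewrite addrC hY.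
by apply: bigO_eq (bigON y_power_dist) _ => p _; rewrite opprB.
Qed.

Let X1_O := X_O y1_O hX1.
Let X2_O := X_O y2_O hX2.

Lemma inv_O X : Om k%:Z X -> O 0 (fun p => (X p)^-1).
Proof. by move=> /bigO_inv; apply: bigO_weaken; lia. Qed.

Lemma ev2_O u X y : (ydeg u <= K0)%N -> Om k%:Z X -> O 1 y ->
  O K0%:Z (fun p => ev2 u (X p)^-1 (y p)).
Proof.
move=> du OX Oy; apply: bigO_weaken (bigO_ev2_0 u (inv_O OX) Oy).
by rewrite lez_nat.
Qed.

Let zeta1 p := ev2 z (X1 p)^-1 (y1 p).
Let zeta2 p := ev2 z (X2 p)^-1 (y2 p).
Let Z1 p := X1 p + zeta1 p.
Let Z2 p := X2 p + zeta2 p.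
Let r1 p := ev2 r (X1 p)^-1 (y1 p).
Let r2 p := ev2 r (X2 p)^-1 (y2 p).
Let E1 p := (X1 p)^-1 ^+ (1 + a * N) * ev2 e (X1 p)^-1 (y1 p).
Let E2 p := (X2 p)^-1 ^+ (1 + a * N) * ev2 e (X2 p)^-1 (y2 p).

Let zeta1_O : O K0%:Z zeta1 := ev2_O dz X1_Om y1_O.
Let zeta2_O : O K0%:Z zeta2 := ev2_O dz X2_Om y2_O.
Let r1_O : O K0%:Z r1 := ev2_O dr X1_Om y1_O.
Let r2_O : O K0%:Z r2 := ev2_O dr X2_Om y2_O.

Let Z1_O : O k%:Z Z1.
Proof. by apply: bigOD X1_O (bigO_weaken _ zeta1_O); lia. Qed.

Let Z2_O : O k%:Z Z2.
Proof. by apply: bigOD X2_O (bigO_weaken _ zeta2_O); lia. Qed.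

Let Z2_Om : Om k%:Z Z2.
Proof. by apply: bigOmega_O X2_Om zeta2_O; lia. Qed.

Let X_neq0 : ev (fun p => X1 p != 0 /\ X2 p != 0).
Proof. exact: eventually_and (bigOmega_neq0 X1_Om) (bigOmega_neq0 X2_Om). Qed.

Let root_equation : ev (fun p => Z1 p ^+ a - Z2 p ^+ a = E1 p - E2 p).
Proof.
apply: eventually_imp X_neq0 _ => p Dp _ [X10 X20].
have [-> _] := expansion (y1 p) X10; have [-> _] := expansion (y2 p) X20.
by rewrite hB // /E1 /E2; ring.
Qed.

Let product_equation : ev (fun p =>
  P.[Z1 p] + c * (X1 p * y1 p) + r1 p = P.[Z2 p] + c * (X2 p * y2 p) + r2 p).
Proof.
apply: eventually_imp X_neq0 _ => p Dp _ [X10 X20].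
have [_ <-] := expansion (y1 p) X10; have [_ <-] := expansion (y2 p) X20.
by rewrite hB // hH.
Qed.

Lemma remainder_O X y : Om k%:Z X -> O 1 y ->
  O (- (k * a * N)%N%:Z - 1)
    (fun p => (X p)^-1 ^+ (1 + a * N) * ev2 e (X p)^-1 (y p)).
Proof.
move=> OX Oy; apply: bigO_weaken (bigOM (bigOX (1 + a * N) (bigO_inv OX)) (ev2_O de OX Oy)).
rewrite PoszD -mulnA !PoszM; nia.
Qed.

Lemma root_distance : O (- (k * a * N)%N%:Z - 1) (fun p => Z1 p ^+ a - Z2 p ^+ a).
Proof.
apply: bigO_ext (bigOB (remainder_O X1_Om y1_O) (remainder_O X2_Om y2_O)) _.
by apply: eventually_imp root_equation _ => p _ _ ->.
Qed.


(** When the two roots differ by a factor [w != 1], comparing the two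
    expansions bounds a polynomial in [Z2] by [w * y1 - y2]; hence [y2] is close
    to [w * y1] and, as [a] divides [k], the power [y ^ k] does not see [w]. *)
Lemma distinct_roots_bounded (w : K) : w ^+ a = 1 -> w != 1 ->
  O (- (k * N)%N%:Z) (fun p => Z1 p - w * Z2 p) -> ev (fun=> False).
Proof.
move=> wa w1 OU; pose U p := Z1 p - w * Z2 p.
have k0 : 0 < k%:Z by lia.
have OU0 : O 0 U by apply: bigO_weaken OU; lia.
pose Q := P \Po (w *: 'X) - P.
have evQ Z : Q.[Z] = P.[w * Z] - P.[Z].
  by rewrite /Q hornerD hornerN horner_comp hornerZ hornerX.
have /coef0_factor[Q' eQ] : Q`_0 = 0 by rewrite -horner_coef0 evQ mulr0 subrr.
have OwZ2 : O k%:Z (fun p => w * Z2 p) := bigO_scale w Z2_O.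
pose q p := divided_difference P (Z1 p) (w * Z2 p).
have Oq : O (k%:Z * N%:Z) q := bigO_divided_difference (ltW k0) sP Z1_O OwZ2.
have OUq : O 0 (fun p => U p * q p).
  by have := bigOM OU Oq; rewrite PoszM addNr.
(* [Z2 * W] is the difference of the two expansions, up to small terms *)
pose W p := Q'.[Z2 p] + c * (w * y1 p - y2 p).
pose rest p := r2 p - r1 p - U p * q p + c * (zeta1 p * y1 p - zeta2 p * y2 p - U p * y1 p).
have Orest : O (K0%:Z + 1) rest.
  have w0 l : l <= K0%:Z + 1 -> forall s, O l s -> O (K0%:Z + 1) s.
    by move=> lel s; apply: bigO_weaken.
  have wK : K0%:Z <= K0%:Z + 1 by lia.
  have w00 : 0 <= K0%:Z + 1 by lia.
  have w1' : 0 + 1 <= K0%:Z + 1 by lia.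
  apply: bigOD; first apply: bigOB; first apply: bigOB.
  - exact: w0 wK _ r2_O.
  - exact: w0 wK _ r1_O.
  - exact: w0 w00 _ OUq.
  apply: bigO_scale; apply: bigOB; first apply: bigOB.
  - exact: bigOM zeta1_O y1_O.
  - exact: bigOM zeta2_O y2_O.
  - exact: w0 w1' _ (bigOM OU0 y1_O).
have OW : O (- 1) W.
  have := bigOM (bigO_inv Z2_Om) Orest => OW.
  apply: bigO_weaken (bigO_ext OW _); first by lia.
  apply: eventually_imp2 product_equation (bigOmega_neq0 Z2_Om) _ => p _ _ eP Z20.
  apply: (mulfI Z20); rewrite mulrA mulfV // mul1r /W mulrDr.
  have -> : Z2 p * Q'.[Z2 p] = Q.[Z2 p] by rewrite eQ hornerM hornerX.
  rewrite evQ.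
  have eP1 : P.[Z1 p] - P.[w * Z2 p] = U p * q p := divided_differenceP _ _ _.
  have -> : P.[w * Z2 p] = P.[Z1 p] - U p * q p by rewrite -eP1; ring.
  have -> : P.[Z1 p] = P.[Z2 p] + c * (X2 p * y2 p) + r2 p - c * (X1 p * y1 p) - r1 p.
    by rewrite -eP; ring.
  rewrite /rest /U /Z1 /Z2; ring.
have Oy : O 1 (fun p => c * (w * y1 p - y2 p)).
  exact: bigO_scale (bigOB (bigO_scale w y1_O) y2_O).
have [sQ'|sQ'] := leqP (size Q') 1; last first.
  (* a nonconstant polynomial in [Z2] is at least of order [Y ^ k] *)
  have [d ed] : exists d, size Q' = d.+2 by exists (size Q').-2; lia.
  apply: (bigOmega_bigO_bounded (l := 1)) (bigOmega_horner k0 ed Z2_O Z2_Om) _.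
    by rewrite -PoszM; have := k_ge; nia.
  have OW1 : O 1 W by apply: bigO_weaken OW.
  by apply: bigO_eq (bigOB OW1 Oy) _ => p _; rewrite addrK.
have Owy : O 0 (fun p => w * y1 p - y2 p).
  have OW0 : O 0 W by apply: bigO_weaken OW.
  apply: bigO_eq (bigO_scale c^-1 (bigOB OW0 (bigO_cst D Y Q'`_0))) _ => p _.
  by rewrite /W (size1_polyC sQ') hornerC coefC addrC addrA addNr add0r mulKf.
(* [X1] is close both to [X2] and to [w * X2] *)
have wk : w ^+ k = 1 by rewrite /k exprM wa expr1n.
have Oyk : O (k%:Z - 1) (fun p => y1 p ^+ k - y2 p ^+ k).
  apply: bigO_eq (bigO_weaken _ (bigO_expB k (bigO_scale w y1_O) y2_O Owy)) _.
    by have := k_ge; lia.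
  by move=> p _; rewrite exprMn wk mul1r.
have le1 : 1 <= k%:Z - 1 by have := k_ge; lia.
have OX : O (k%:Z - 1) (fun p => X1 p - X2 p).
  apply: bigO_eq (bigOD Oyk (bigO_weaken le1 (bigOB hX1 hX2))) _ => p _; ring.
have OwX : O (k%:Z - 1) (fun p => X1 p - w * X2 p).
  have leK : K0%:Z <= k%:Z - 1 by have := k_ge; lia.
  have le0 : 0 <= k%:Z - 1 by have := k_ge; lia.
  apply: bigO_eq (bigOB (bigO_weaken le0 OU0)
    (bigO_weaken leK (bigOB zeta1_O (bigO_scale w zeta2_O)))) _ => p _.
  rewrite /U /Z1 /Z2; ring.
have w10 : w - 1 != 0 by rewrite subr_eq0.
apply: (bigOmega_bigO_bounded (l := k%:Z - 1)) (bigOmega_scale w10 X2_Om) _; first by lia.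
by apply: bigO_eq (bigOB OX OwX) _ => p _; ring.
Qed.


Hypothesis hne : forall p, D p -> X1 p = X2 p -> y1 p = y2 p -> False.

(** When the two roots are close, [X1 - X2] is a multiple of [y1 - y2], because
    [B] is almost the power [Z ^ a] of a coordinate [Z].  The difference of the two
    expansions, divided by [y1 - y2], then consists of [c * X1], which has order
    [Y ^ k], and of terms of smaller order. *)
Lemma close_roots_bounded :
  O (- (k * N)%N%:Z) (fun p => Z1 p - Z2 p) -> ev (fun=> False).
Proof.
move=> OU; pose U p := Z1 p - Z2 p; have kge := k_ge.
have eA := degree_pred; set a' := a.-1%:Z in eA.
pose t1 p := (X1 p)^-1; pose t2 p := (X2 p)^-1.
have Ot1 : O (- k%:Z) t1 := bigO_inv X1_Om.
have Ot2 : O (- k%:Z) t2 := bigO_inv X2_Om.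
have Ot10 : O 0 t1 := inv_O X1_Om; have Ot20 : O 0 t2 := inv_O X2_Om.
have weak (u : {poly {poly K}}) (m : T -> K) : (ydeg u <= K0)%N -> O (ydeg u)%:Z m -> O K0%:Z m.
  by move=> du; apply: bigO_weaken; rewrite lez_nat.
have [A [A' [/(weak _ _ dz) OA /(weak _ _ dz) OA' dzE]]] :=
  ev2_divided_difference z Ot10 Ot20 y1_O y2_O.
have [Ae [Be [/(weak _ _ de) OAe /(weak _ _ de) OBe deE]]] :=
  ev2_divided_difference e Ot10 Ot20 y1_O y2_O.
have [Ar [Br [/(weak _ _ dr) OAr /(weak _ _ dr) OBr drE]]] :=
  ev2_divided_difference r Ot10 Ot20 y1_O y2_O.
pose dX p := X1 p - X2 p; pose dY p := y1 p - y2 p; pose tt p := t1 p * t2 p.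
have Ott : O (- k%:Z - k%:Z) tt := bigOM Ot1 Ot2.
have dt : ev (fun p => t1 p - t2 p = - (dX p * tt p)).
  apply: eventually_imp X_neq0 _ => p _ _ [X10 X20].
  by rewrite /t1 /t2 /dX /tt /t1 /t2; field; rewrite X10 X20.
pose n := (1 + a * N)%N.
pose G p := \sum_(i < n) t1 p ^+ (n.-1 - i) * t2 p ^+ i.
have OG : O (- k%:Z * n.-1%:Z) G := bigO_geometric n Ot1 Ot2.
pose e1 p := ev2 e (t1 p) (y1 p).
have Oe1 : O K0%:Z e1 := ev2_O de X1_Om y1_O.
pose al p := - (tt p * (G p * e1 p + t2 p ^+ n * Ae p)).
pose be p := t2 p ^+ n * Be p.
have nE : n%:Z = n.-1%:Z + 1 by rewrite /n; lia.
have n1E : n.-1%:Z = a%:Z * N%:Z by rewrite /n -PoszM.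
have Oal : O (- k%:Z * a%:Z * N%:Z - k%:Z - k%:Z + K0%:Z) al.
  apply/bigON/(bigO_weaken _ (bigOM Ott (bigOD (bigOM OG Oe1)
    (bigO_weaken _ (bigOM (bigOX n Ot2) OAe))))); rewrite ?nE n1E; nia.
have Obe : O (- k%:Z * a%:Z * N%:Z - k%:Z + K0%:Z) be.
  apply: bigO_weaken (bigOM (bigOX n Ot2) OBe); rewrite nE n1E; nia.
(* the difference of the remainders of [Z ^ a], in terms of [dX] and [dY] *)
have EE : ev (fun p => Z1 p ^+ a - Z2 p ^+ a = dX p * al p + dY p * be p).
  apply: eventually_imp2 root_equation dt _ => p _ _ -> dtp.
  have -> : E1 p - E2 p = (t1 p ^+ n - t2 p ^+ n) * e1 p
      + t2 p ^+ n * (ev2 e (t1 p) (y1 p) - ev2 e (t2 p) (y2 p)).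
    by rewrite /E1 /E2 /e1 /t1 /t2 -/n; ring.
  by rewrite deE subrXX -/(G p) dtp /al /be /dY; ring.
(* the quotient of [Z1 ^ a - Z2 ^ a] by [Z1 - Z2], close to [a * Z2 ^ a.-1] *)
pose S p := \sum_(i < a) Z1 p ^+ (a.-1 - i) * Z2 p ^+ i.
have OS : O (k%:Z * a') S := bigO_geometric a Z1_O Z2_O.
have a_neq0 : a%:R != 0 :> K by rewrite pnatr_eq0 -lt0n.
have SOm : Om (k%:Z * a') S.
  apply: (bigOmega_perturb (l := k%:Z * a' - 1))
    (bigOmega_scale a_neq0 (bigOmegaX a.-1 Z2_Om)) _; first by lia.
  have Of i : (i < a)%N ->
      O (k%:Z * a' - 1) (fun p => (Z1 p ^+ (a.-1 - i) - Z2 p ^+ (a.-1 - i)) * Z2 p ^+ i).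
    move=> lti; case em : (a.-1 - i)%N => [|m].
      by apply: bigO_eq (bigO0 D Y _) _ => p _; rewrite !expr0 subrr mul0r.
    apply: bigO_weaken (bigOM (bigO_expB m.+1 Z1_O Z2_O OU) (bigOX i Z2_O)).
    have -> : a' = (m%:Z + 1) + i%:Z by rewrite /a'; lia.
    rewrite PoszM /=; nia.
  apply: bigO_eq (bigO_sum Of) _ => p _.
  have -> : a%:R * Z2 p ^+ a.-1 = \sum_(i < a) Z2 p ^+ a.-1.
    by rewrite sumr_const card_ord mulr_natl.
  rewrite /S -sumrB.
  apply: eq_bigr => i _; rewrite mulrBl; congr (_ - _).
  by rewrite -exprD subnK //; have := ltn_ord i; lia.
have US p : U p * S p = Z1 p ^+ a - Z2 p ^+ a by rewrite subrXX.
have Udiff : ev (fun p => U p = dX p * (1 - tt p * A p) + dY p * A' p).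
  apply: eventually_imp dt _ => p _ _ dtp.
  have -> : U p = dX p + (ev2 z (t1 p) (y1 p) - ev2 z (t2 p) (y2 p)).
    by rewrite /U /Z1 /Z2 /zeta1 /zeta2 /dX /t1 /t2; ring.
  by rewrite dzE dtp /dY; ring.
(* eliminating [U] from the two formulas leaves [dX * V] proportional to [dY] *)
pose V p := S p * (1 - tt p * A p) - al p.
have VOm : Om (k%:Z * a') V.
  apply: (bigOmega_perturb (l := k%:Z * a' - 1)) SOm _; first by lia.
  have O1 : O (k%:Z * a' - 1) (fun p => S p * (tt p * A p)).
    by apply: bigO_weaken (bigOM OS (bigOM Ott OA)); lia.
  have O2 : O (k%:Z * a' - 1) al by apply: bigO_weaken Oal; nia.
  by apply: bigO_eq (bigON (bigOD O1 O2)) _ => p _; rewrite /V; ring.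
have dXV : ev (fun p => dX p * V p = dY p * (be p - S p * A' p)).
  apply: eventually_imp2 Udiff EE _ => p _ _ eU eE; have := US p.
  rewrite eE eU /V => eq.
  have -> : dY p * (be p - S p * A' p) =
    (dX p * al p + dY p * be p) - dX p * al p - dY p * S p * A' p by ring.
  by rewrite -eq; ring.
pose DX p := (be p - S p * A' p) * (V p)^-1.
have ODX : O K0%:Z DX.
  have O1 : O (k%:Z * a' + K0%:Z) (fun p => be p - S p * A' p).
    by apply: bigOB (bigO_weaken _ Obe) (bigOM OS OA'); nia.
  by apply: bigO_weaken (bigOM O1 (bigO_inv VOm)); lia.
have dXE : ev (fun p => dX p = dY p * DX p).
  apply: eventually_imp2 dXV (bigOmega_neq0 VOm) _ => p _ _ eV V0.
  by apply: (mulIf V0); rewrite eV /DX mulrA mulfVK.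
have dY0 : ev (fun p => dY p != 0).
  apply: eventually_imp dXE _ => p Dp _ eX; apply/eqP => Y0.
  apply: (hne Dp); apply/eqP; rewrite -subr_eq0 -?[_ - _]/(dX p) ?eX -/(dY p) Y0 ?mul0r //.
pose DZ p := (DX p * al p + be p) * (S p)^-1.
have ODZ : O (- (k%:Z * N%:Z)) DZ.
  have O1 : O (- (k%:Z * a%:Z * N%:Z)) (fun p => DX p * al p + be p).
    by apply: bigOD; [apply: bigO_weaken (bigOM ODX Oal) | apply: bigO_weaken Obe]; nia.
  by apply: bigO_weaken (bigOM O1 (bigO_inv SOm)); nia.
have UE : ev (fun p => U p = dY p * DZ p).
  apply: eventually_imp (eventually_and (eventually_and EE dXE) (bigOmega_neq0 SOm)) _.
  move=> p _ _ [[eE eX] S0].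
  by apply: (mulIf S0); rewrite US eE eX /DZ -[RHS]mulrA mulfVK //; ring.
pose q p := divided_difference P (Z1 p) (Z2 p).
have Oq : O (k%:Z * N%:Z) q.
  exact: bigO_divided_difference.
(* the difference of the two expansions is [dY * (c * X1 + rest)] *)
pose rest p := DZ p * q p + c * (DX p * y2 p) - DX p * tt p * Ar p + Br p.
have Orest : O (K0%:Z + 1) rest.
  apply: bigOD; first apply: bigOB; first apply: bigOD.
  - by apply: bigO_weaken (bigOM ODZ Oq); lia.
  - exact: bigO_scale (bigOM ODX y2_O).
  - by apply: bigO_weaken (bigOM (bigOM ODX Ott) OAr); lia.
  - by apply: bigO_weaken OBr; lia.
apply: (bigOmega_bigO_bounded (l := K0%:Z + 1)) (bigOmega_scale c0 X1_Om) _; first by lia.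
apply: bigO_ext (bigON Orest) _.
apply: eventually_imp (eventually_and (eventually_and UE dXE)
  (eventually_and product_equation (eventually_and dt dY0))) _.
move=> p _ _ [[eU eX] [eP [dtp Y0]]]; apply: (mulfI Y0).
have eP1 : P.[Z1 p] - P.[Z2 p] = U p * q p := divided_differenceP _ _ _.
have eR : r1 p - r2 p = (t1 p - t2 p) * Ar p + dY p * Br p := drE p.
have e0 : (P.[Z1 p] - P.[Z2 p]) + c * (X1 p * dY p + dX p * y2 p) + (r1 p - r2 p) = 0.
  move/eqP: eP; rewrite -subr_eq0 => /eqP <-; rewrite /dX /dY; ring.
rewrite eP1 eR dtp eU eX in e0.
apply/eqP; rewrite -subr_eq0; apply/eqP/(oppr_inj); rewrite oppr0 -{}e0 /rest; ring.
Qed.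

End Coincidences.

(** * Splitting according to the ratio of the two roots *)

Lemma roots_of_unity (K : closedFieldType) n : (0 < n)%N -> exists rs : seq K,
  [/\ size rs = n, (forall w, w \in rs -> w ^+ n = 1) &
      forall u v : K, u ^+ n - v ^+ n = \prod_(w <- rs) (u - w * v)].
Proof.
move=> n0; have [rs] := closed_field_poly_normal ('X^n - 1 : {poly K}).
have /monicP -> : 'X^n - 1 \is @monic K by exact: monicXnsubC.
rewrite scale1r => ers; exists rs.
have srs : size rs = n.
  by have := size_XnsubC (1 : K) n0; rewrite ers size_prod_XsubC => -[].
split=> // [w wrs|u v].
  have : root ('X^n - 1) w by rewrite ers root_prod_XsubC.
  by rewrite rootE hornerD hornerN hornerXn hornerC subr_eq0 => /eqP.
have [->|v0] := eqVneq v 0.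
  rewrite expr0n gtn_eqF // subr0 -{1}srs; elim: rs {ers srs} => [|w rs IH].
    by rewrite big_nil expr0.
  by rewrite big_cons -IH exprS mulr0 subr0.
have := congr1 (horner^~ (u / v)) ers.
rewrite hornerD hornerN hornerXn hornerC horner_prod => e.
have -> : u ^+ n - v ^+ n = v ^+ n * ((u / v) ^+ n - 1).
  by rewrite mulrBr mulr1 -exprMn mulrCA mulfV ?mulr1.
rewrite e -{1}srs; elim: rs {ers srs e} => [|w rs IH].
  by rewrite !big_nil mulr1.
rewrite !big_cons -IH /= exprS hornerXsubC; field; exact: v0.
Qed.

Lemma small_factor (K : numFieldType) (s : K) (I : eqType) (rs : seq I) (f : I -> K) :
  0 < s -> (0 < size rs)%N -> `|\prod_(w <- rs) f w| <= s ^+ size rs ->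
  exists2 w, w \in rs & `|f w| <= s.
Proof.
move=> s0 rs0 le_prod.
have [/hasP[w wrs le_w]|/hasPn no] := boolP (has (fun w => `|f w| <= s) rs); first by exists w.
have lt_f w : w \in rs -> s < `|f w|.
  by move=> /no; rewrite -real_ltNge ?normr_real ?gtr0_real.
suff : s ^+ size rs < `|\prod_(w <- rs) f w| by move=> /lt_geF; rewrite le_prod.
elim: rs rs0 lt_f {no le_prod} => // w rs IH _ lt_f.
rewrite big_cons normrM /= exprS.
have lt_w : s < `|f w| by apply: lt_f; rewrite mem_head.
case: rs IH lt_f => [|w' rs] IH lt_f; first by rewrite big_nil normr1 expr0 !mulr1.
apply: ltr_pM => //; rewrite ?exprn_ge0 ?ltW //; apply: IH => // v vrs.
by apply: lt_f; rewrite in_cons vrs orbT.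
Qed.

Lemma bigO_sub (K : numFieldType) (T : Type) (D D' : T -> Prop) (Y : T -> K) l s :
  (forall p, D' p -> D p) -> bigO D Y l s -> bigO D' Y l s.
Proof. by move=> sub [C [C0 OC]]; exists C; split=> //; apply: eventually_sub OC. Qed.

(** A gauge bounded on finitely many pieces that cover [D] eventually is bounded
    on [D]. *)
Lemma eventually_cases (K : numFieldType) (T : Type) (D : T -> Prop) (Y : T -> K)
    (I : eqType) (rs : seq I) (Q : I -> T -> Prop) :
  (forall w, w \in rs -> eventually (fun p => D p /\ Q w p) Y (fun=> False)) ->
  eventually D Y (fun p => exists2 w, w \in rs & Q w p) ->
  eventually D Y (fun=> False).
Proof.
move=> cases ex.
have none : eventually D Y (fun p => forall w, w \in rs -> ~ Q w p).
  elim: rs cases {ex} => [_|w rs IH cases]; first by apply: eventually_all => p _ w.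
  have IH' := IH (fun v vrs => cases v (mem_behead (vrs : v \in behead (w :: rs)))).
  have [M [M1 HM]] := cases w (mem_head _ _).
  have Ew : eventually D Y (fun p => ~ Q w p).
    by exists M; split=> // p Dp MY Qw; apply: (HM p).
  apply: eventually_imp2 Ew IH' _ => p _ _ nw nrs v.
  by rewrite in_cons => /predU1P[->|]; [|exact: nrs].
by apply: eventually_imp2 none ex _ => p _ _ no [w wrs Qw]; apply: no wrs Qw.
Qed.

(** The exponent [k] is large enough for [y ^ k] to dominate the coefficients
    of the expansion, and divisible by [a], so that [(w * y) ^ k = y ^ k] when
    [w ^ a = 1]. *)
Lemma dominated_double_points_bounded (K : numClosedFieldType) (a : nat)
    (B H : {poly {poly K}}) (c : K) :
  (0 < a)%N -> B \is monic -> size B = a.+1 -> c != 0 ->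
  B^`() * dy H - dy B * H^`() = c%:P%:P ->
  exists k : nat, forall C : K, 0 <= C -> exists M : K, 1 <= M /\
    forall x1 y1 x2 y2 : K, let Y := `|y1| + `|y2| in
      `|x1| <= C * Y -> `|x2| <= C * Y ->
      ev2 B (x1 + y1 ^+ k) y1 = ev2 B (x2 + y2 ^+ k) y2 ->
      ev2 H (x1 + y1 ^+ k) y1 = ev2 H (x2 + y2 ^+ k) y2 ->
      M <= Y -> x1 = x2 /\ y1 = y2.
Proof.
move=> a0 monB sB c0 eJ.
have [N [P [z [e [r [sP expansion]]]]]] :=
  asymptotic_expansion (pchar_num K) a0 monB sB eJ.
have ca0 : c / a%:R != 0 by rewrite mulf_neq0 // invr_eq0 pnatr_eq0 -lt0n.
pose K0 := (ydeg (B - 'X^a) + ydeg z + ydeg e + ydeg r)%N.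
have dB : (ydeg (B - 'X^a)%R <= K0)%N by rewrite /K0; lia.
have dz : (ydeg z <= K0)%N by rewrite /K0; lia.
have de : (ydeg e <= K0)%N by rewrite /K0; lia.
have dr : (ydeg r <= K0)%N by rewrite /K0; lia.
pose k := (a * (K0 + 2))%N; exists k => C C0.
pose T := ((K * K) * (K * K))%type.
pose x1 (p : T) := p.1.1; pose y1 (p : T) := p.1.2.
pose x2 (p : T) := p.2.1; pose y2 (p : T) := p.2.2.
pose X1 p := x1 p + y1 p ^+ k; pose X2 p := x2 p + y2 p ^+ k.
pose Y p := `|y1 p| + `|y2 p|.
pose D p := [/\ `|x1 p| <= C * Y p, `|x2 p| <= C * Y p,
  ev2 B (X1 p) (y1 p) = ev2 B (X2 p) (y2 p),
  ev2 H (X1 p) (y1 p) = ev2 H (X2 p) (y2 p) & ~ (x1 p = x2 p /\ y1 p = y2 p)].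
suff [M [M1 HM]] : eventually D Y (fun=> False).
  exists M; split=> // u1 v1 u2 v2; cbv zeta => le1 le2 eB eH leM.
  have [eq|ne] := boolP ((u1 == u2) && (v1 == v2)).
    by move/andP: eq => [/eqP -> /eqP ->].
  case: (HM ((u1, v1), (u2, v2))) => //; split=> // -[/= eu ev].
  by move: ne; rewrite /x1 /x2 /y1 /y2 /= in eu ev *; rewrite eu ev !eqxx.
have hY p : D p -> Y p = `|y1 p| + `|y2 p| by [].
have hX1 : bigO D Y 1 (fun p => X1 p - y1 p ^+ k).
  exists C; split=> //; apply: eventually_all => p [le1 _ _ _ _].
  by rewrite expr1z /X1 addrK.
have hX2 : bigO D Y 1 (fun p => X2 p - y2 p ^+ k).
  exists C; split=> //; apply: eventually_all => p [_ le2 _ _ _].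
  by rewrite expr1z /X2 addrK.
have hB p : D p -> ev2 B (X1 p) (y1 p) = ev2 B (X2 p) (y2 p) by case.
have hH p : D p -> ev2 H (X1 p) (y1 p) = ev2 H (X2 p) (y2 p) by case.
have hne p : D p -> X1 p = X2 p -> y1 p = y2 p -> False.
  move=> [_ _ _ _ ne] eX ey; apply: ne; split=> //.
  by move: eX; rewrite /X1 /X2 ey => /addIr.
pose Z1 p := X1 p + ev2 z (X1 p)^-1 (y1 p).
pose Z2 p := X2 p + ev2 z (X2 p)^-1 (y2 p).
have [rs [srs rs1 prodrs]] := roots_of_unity K a0.
(* the piece of the points whose roots have ratio close to [w] *)
pose Q w p := `|Z1 p - w * Z2 p| <= Y p ^ (- (k * N)%N%:Z).
apply: (eventually_cases (rs := rs) (Q := Q)) => [w wrs|].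
  have sub p : D p /\ Q w p -> D p by case.
  have OU : bigO (fun p => D p /\ Q w p) Y (- (k * N)%N%:Z) (fun p => Z1 p - w * Z2 p).
    by exists 1; split=> //; apply: eventually_all => p [_]; rewrite mul1r.
  have hX1' := bigO_sub sub hX1; have hX2' := bigO_sub sub hX2.
  have [w1|w1] := eqVneq w 1; last first.
    by apply: (distinct_roots_bounded a0 monB sB ca0 sP expansion dB dz de dr _
      hX1' hX2' _ _ (rs1 w wrs) w1 OU) => p [Dp _]; [exact: hY | exact: hB | exact: hH].
  have OU1 : bigO (fun p => D p /\ Q w p) Y (- (k * N)%N%:Z) (fun p => Z1 p - Z2 p).
    by apply: bigO_eq OU _ => p _; rewrite w1 mul1r.
  by apply: (close_roots_bounded a0 monB sB ca0 sP expansion dB dz de dr _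
      hX1' hX2' _ _ _ OU1) => p [Dp _]; [exact: hY | exact: hB | exact: hH | exact: hne].
have [E [E0 OE]] := root_distance a0 monB sB ca0 sP expansion dB dz de dr hY hX1 hX2 hB.
apply: eventually_imp2 OE (eventually_ge _ _ E0) _ => p Dp Y1 le_prod leE.
have Y0 : 0 < Y p := lt_le_trans ltr01 Y1.
apply: (small_factor (f := fun w => Z1 p - w * Z2 p)); rewrite ?exprz_gt0 ?srs //.
rewrite -prodrs; apply: le_trans le_prod _.
have -> : (Y p ^ (- (k * N)%N%:Z)) ^+ a = Y p * Y p ^ (- (k * a * N)%N%:Z - 1).
  rewrite -[X in X * _]expr1z -expfzDr ?gt_eqF // exprnP exprz_exp.
  by congr (_ ^ _); lia.
by rewrite ler_pM2r ?exprz_gt0.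
Qed.

(** * Polynomial maps and their Jacobians *)

(** Identities between ring morphisms and derivations need only be checked on
    constants and variables. *)
Lemma mpoly_gen_ind (n : nat) (K : nzRingType) (Q : {mpoly K[n]} -> Prop) :
  (forall c, Q c%:MP) -> (forall i, Q 'X_i) ->
  (forall F G, Q F -> Q G -> Q (F + G)) -> (forall F G, Q F -> Q G -> Q (F * G)) ->
  forall F, Q F.
Proof.
move=> QC QX QD QM F; rewrite [F]mpolyE; elim: (msupp F) => [|m s IH].
  by rewrite big_nil -[0]/(0%:MP) //; have := QC 0; rewrite mpolyC0.
rewrite big_cons; apply: QD => //; rewrite -mul_mpolyC; apply: (QM) => //.
rewrite mpolyXE_id; elim/big_rec: _ => [|i G _ QG]; first by have := QC 1; rewrite mpolyC1.
apply: (QM) => //; elim: (m i) => [|j IHj]; first by have := QC 1; rewrite mpolyC1.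
by rewrite exprS; apply: QM.
Qed.

Section ChainRule.
Variables (K A : comNzRingType) (h : {rmorphism {mpoly K[2]} -> A}).

Lemma mderivXU (i j : 'I_2) : ('X_j : {mpoly K[2]})^`M(i) = (i == j)%:R.
Proof.
rewrite mderivX mnm1E eq_sym; case: eqP => [->|_]; last by rewrite scale0r.
by rewrite scale1r -mpolyX0; congr 'X_[_]; apply/mnmP => k; rewrite mnmBE subnn mnm0E.
Qed.

Definition derivation (D : A -> A) :=
  [/\ forall u v, D (u + v) = D u + D v,
      forall u v, D (u * v) = D u * v + u * D v & forall c, D (h c%:MP) = 0].

Lemma chain_rule D : derivation D -> forall F,
  D (h F) = h F^`M(ix) * D (h 'X_ix) + h F^`M(iy) * D (h 'X_iy).
Proof.
case=> DD DM DC; apply: mpoly_gen_ind => [c|i|F G IHF IHG|F G IHF IHG].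
- by rewrite DC !mderivC !rmorph0 !mul0r addr0.
- rewrite !mderivXU; case: i => -[|[|//]] lti.
    have -> : Ordinal lti = ix by apply: val_inj.
    by rewrite eqxx rmorph1 mul1r rmorph0 mul0r addr0.
  have -> : Ordinal lti = iy by apply: val_inj.
  by rewrite eqxx rmorph1 mul1r rmorph0 mul0r add0r.
- by rewrite rmorphD DD IHF IHG !mderivD !rmorphD /=; ring.
- by rewrite rmorphM DM IHF IHG !mderivM !rmorphD !rmorphM /=; ring.
Qed.

(** The multiplicativity of two by two determinants, for the rows [D] and [E]. *)
Lemma jacobian_chain_rule D E : derivation D -> derivation E -> forall F G,
  D (h F) * E (h G) - E (h F) * D (h G) =
  h (jacobian F G) * (D (h 'X_ix) * E (h 'X_iy) - E (h 'X_ix) * D (h 'X_iy)).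
Proof.
move=> dD dE F G; rewrite (chain_rule dD F) (chain_rule dD G).
rewrite (chain_rule dE F) (chain_rule dE G) /jacobian rmorphB !rmorphM /=.
ring.
Qed.

End ChainRule.

(** The substitution [x := X, y := y + t * X], with [X] as outer variable. *)
Section Shear.
Variables (K : fieldType) (t : K).

Definition shear_var (i : 'I_2) : {poly {poly K}} :=
  if i == ix then 'X else 'X%:P + t%:P%:P * 'X.

Definition shear : {rmorphism {mpoly K[2]} -> {poly {poly K}}} :=
  mmap (@polyC {poly K} \o @polyC K) shear_var.

Lemma shearC c : shear c%:MP = c%:P%:P.
Proof. exact: mmapC. Qed.

Lemma shearX i : shear 'X_i = shear_var i.
Proof. by rewrite /shear /= mmapX mmap1U. Qed.

Lemma shear_derivation : derivation shear (@deriv _).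
Proof.
split=> [u v|u v|c]; [exact: derivD | exact: derivM | by rewrite shearC derivC].
Qed.

Lemma shear_dy_derivation : derivation shear (@dy K).
Proof.
split=> [u v|u v|c]; [exact: dyD | exact: dyM | by rewrite shearC dyC derivC].
Qed.

Lemma shear_jacobian F G (c : K) : jacobian F G = c%:MP ->
  (shear F)^`() * dy (shear G) - dy (shear F) * (shear G)^`() = c%:P%:P.
Proof.
move=> eJ; rewrite (jacobian_chain_rule shear_derivation shear_dy_derivation) eJ shearC.
rewrite !shearX /shear_var /= derivX dyX !derivD dyD !dyM !dyC !derivC dyX derivX derivM.
by rewrite !derivC ?derivX; ring.
Qed.

(** The homogeneous part of top degree of [F], restricted to the line [x = 1]. *)
Definition top_form (F : {mpoly K[2]}) : {poly K} :=
  \sum_(m <- msupp F | mdeg m == (msize F).-1) F@_m *: 'X^(m iy).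

Lemma mdeg2 (m : 'X_{1..2}) : mdeg m = (m ix + m iy)%N.
Proof.
rewrite mdegE big_ord_recl big_ord1; congr (m _ + m _)%N; exact: val_inj.
Qed.

Lemma mnm2_inj (m m' : 'X_{1..2}) : mdeg m = mdeg m' -> m iy = m' iy -> m = m'.
Proof.
rewrite !mdeg2 => ed ey; have ex : m ix = m' ix by lia.
apply/mnmP => -[[|[|//]] lti].
  by have -> : Ordinal lti = ix by apply: val_inj.
by have -> : Ordinal lti = iy by apply: val_inj.
Qed.

(** In two variables the degree and the exponent of [y] determine a monomial, so
    no cancellation occurs. *)
Lemma top_form_neq0 F : F != 0 -> top_form F != 0.
Proof.
move=> F0; have lF := mlead_supp F0; have dF := mlead_deg F0.
apply/negP => /eqP /(congr1 (fun p : {poly K} => p`_(mlead F iy))).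
rewrite /top_form coef_sum coef0 big_mkcond (bigD1_seq (mlead F)) ?msupp_uniq //=.
rewrite -dF eqxx coefZ coefXn eqxx mulr1 big1 ?addr0 => [/eqP|m nm].
  by rewrite mcoeff_eq0 lF.
case: eqP => //= dm; rewrite coefZ coefXn; case: eqP => [ey|_]; last by rewrite mulr0.
by case/eqP: nm; apply: mnm2_inj.
Qed.

Lemma shear_monomial (m : 'X_{1..2}) :
  shear 'X_[m] = 'X^(m ix) * ('X%:P + t%:P%:P * 'X) ^+ m iy.
Proof.
rewrite /shear /= mmapX /mmap1 big_ord_recl big_ord1 /shear_var /=.
congr ('X ^+ m _ * _ ^+ m _); exact: val_inj.
Qed.

Lemma shear_monomial_top (i j : nat) :
  let U := 'X^i * ('X%:P + t%:P%:P * 'X) ^+ j : {poly {poly K}} in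
  (size U <= (i + j).+1)%N /\ U`_(i + j) = (t ^+ j)%:P.
Proof.
set L : {poly {poly K}} := 'X%:P + _; cbv zeta.
have sM (U V : {poly {poly K}}) n m :
    (size U <= n.+1)%N -> (size V <= m.+1)%N -> (size (U * V)%R <= (n + m).+1)%N.
  by move=> sU sV; apply: leq_trans (size_polyMleq _ _) _; lia.
have sL : (size L <= 2)%N.
  apply: leq_trans (size_polyD _ _) _; rewrite geq_max; apply/andP; split.
    exact: leq_trans (size_polyC_leq1 _) _.
  by rewrite mul_polyC; apply: leq_trans (size_scale_leq _ _) _; rewrite size_polyX.
have L1 : L`_1 = t%:P by rewrite /L coefD coefC coefCM coefX /= add0r mulr1.
have [sLj Ljj] : (size (L ^+ j) <= j.+1)%N /\ (L ^+ j)`_j = (t ^+ j)%:P.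
  elim: j => [|j [sj ej]]; first by rewrite !expr0 size_poly1 coef1.
  rewrite exprS; split; first exact: (sM _ _ 1 j).
  by rewrite -[X in _`_X]add1n coefM_top // L1 ej exprS polyCM.
have sX : (size ('X^i : {poly {poly K}}) <= i.+1)%N by rewrite size_polyXn.
by split; [exact: sM | rewrite coefM_top // coefXn eqxx mul1r].
Qed.

Lemma shear_top F d : msize F = d.+1 ->
  (size (shear F) <= d.+1)%N /\ (shear F)`_d = ((top_form F).[t])%:P.
Proof.
move=> dF.
have eF : shear F = \sum_(m <- msupp F) (F@_m)%:P%:P * shear 'X_[m].
  rewrite {1}[F]mpolyE rmorph_sum; apply: eq_bigr => m _.
  by rewrite -mul_mpolyC rmorphM shearC.
split.
  rewrite eF; apply: leq_trans (size_sum _ _ _) _; apply/bigmax_leqP_seq => m mF _.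
  have := msize_mdeg_lt mF; rewrite dF mdeg2 => le.
  rewrite mul_polyC; apply: leq_trans (size_scale_leq _ _) _.
  by rewrite shear_monomial; have [+ _] := shear_monomial_top (m ix) (m iy); lia.
rewrite eF coef_sum /top_form horner_sum rmorph_sum /= [RHS]big_mkcond /=.
rewrite big_seq [RHS]big_seq; apply: eq_bigr => m mF.
have := msize_mdeg_lt mF; rewrite dF mdeg2 => le.
have [sm em] := shear_monomial_top (m ix) (m iy).
rewrite coefCM shear_monomial /=; case: eqP => [ed|ne].
  by rewrite -ed em hornerZ hornerXn polyCM.
by rewrite nth_default ?mulr0 // (leq_trans sm) //; lia.
Qed.

Lemma ev2_shear F X y : ev2 (shear F) X y = eval_at F (X, y + t * X).
Proof.
elim/mpoly_gen_ind: F => [c|i|F G IHF IHG|F G IHF IHG].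
- by rewrite shearC ev2C hornerC /eval_at mevalC.
- rewrite shearX /eval_at mevalXU /shear_var; case: eqP => _ /=; first exact: ev2X.
  by rewrite ev2D ev2M !ev2C ev2X hornerX hornerC.
- by rewrite rmorphD ev2D IHF IHG /eval_at mevalD.
- by rewrite rmorphM ev2M IHF IHG /eval_at mevalM.
Qed.

End Shear.

Section Automorphism.
Variables (K : comNzRingType) (t : K) (k : nat).
Local Notation A := {mpoly K[2]}.

Definition shear_tuple : 2.-tuple A :=
  [tuple 'X_ix + 'X_iy ^+ k; 'X_iy + t%:MP * ('X_ix + 'X_iy ^+ k)].

Definition unshear_tuple : 2.-tuple A :=
  [tuple 'X_ix - ('X_iy - t%:MP * 'X_ix) ^+ k; 'X_iy - t%:MP * 'X_ix].

Definition shear_aut : {lrmorphism A -> A} := comp_mpoly shear_tuple.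

Lemma ord2P (i : 'I_2) : i = ix \/ i = iy.
Proof. by case: i => -[|[|//]] lti; [left|right]; apply: val_inj. Qed.

Lemma comp_mpoly_cancel (s s' : 2.-tuple A) :
  ('X_ix \mPo s) \mPo s' = 'X_ix -> ('X_iy \mPo s) \mPo s' = 'X_iy ->
  forall F, (F \mPo s) \mPo s' = F.
Proof.
move=> ex ey; apply: mpoly_gen_ind => [c|i|F G IHF IHG|F G IHF IHG].
- by rewrite !comp_mpolyC.
- by case: (ord2P i) => ->.
- by rewrite !comp_mpolyD IHF IHG.
- by rewrite !rmorphM /= IHF IHG.
Qed.

Lemma shear_aut_bij : bijective shear_aut.
Proof.
have fx : 'X_ix \mPo shear_tuple = 'X_ix + 'X_iy ^+ k by rewrite comp_mpolyXU.
have fy : 'X_iy \mPo shear_tuple = 'X_iy + t%:MP * ('X_ix + 'X_iy ^+ k).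
  by rewrite comp_mpolyXU.
have gx : 'X_ix \mPo unshear_tuple = 'X_ix - ('X_iy - t%:MP * 'X_ix) ^+ k.
  by rewrite comp_mpolyXU.
have gy : 'X_iy \mPo unshear_tuple = 'X_iy - t%:MP * 'X_ix by rewrite comp_mpolyXU.
exists (comp_mpoly unshear_tuple); apply: comp_mpoly_cancel.
- by rewrite fx comp_mpolyD rmorphXn /= gx gy subrK.
- by rewrite fy comp_mpolyD rmorphM /= comp_mpolyD rmorphXn /= comp_mpolyC gx gy; ring.
- rewrite gx comp_mpolyB rmorphXn /= comp_mpolyB rmorphM /= comp_mpolyC fx fy.
  by set w := t%:MP * _; rewrite (addrK w) addrK.
- by rewrite gy comp_mpolyB rmorphM /= comp_mpolyC fx fy; ring.
Qed.

Lemma mderiv_derivation (i : 'I_2) : derivation shear_aut (mderiv i).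
Proof.
split=> [u v|u v|c]; [exact: mderivD | exact: mderivM |].
by rewrite /= comp_mpolyC mderivC.
Qed.

Lemma mderiv_exp (i : 'I_2) (F : A) n :
  (F ^+ n)^`M(i) = (F ^+ n.-1 * F^`M(i)) *+ n.
Proof.
elim: n => [|n IH]; first by rewrite expr0 -mpolyC1 mderivC mulr0n.
rewrite exprS mderivM IH /= mulrSr addrC [_^`M(i) * _]mulrC; congr (_ + _).
by case: n {IH} => [|n]; rewrite ?mulr0n ?mulr0 // mulrnAr mulrA -exprS.
Qed.

Lemma shear_aut_jacobian F G (c : K) : jacobian F G = c%:MP ->
  jacobian (shear_aut F) (shear_aut G) = c%:MP.
Proof.
move=> eJ; rewrite {1}/jacobian.
rewrite (jacobian_chain_rule (mderiv_derivation ix) (mderiv_derivation iy)) eJ.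
rewrite /= comp_mpolyC !comp_mpolyXU /=.
rewrite !mderivD !mderivM !mderivC !mderivD !mderiv_exp !mderivXU /=.
by rewrite ?eqxx /=; ring.
Qed.

Lemma eval_shear_aut F (p : K * K) : eval_at (shear_aut F) p =
  eval_at F (p.1 + p.2 ^+ k, p.2 + t * (p.1 + p.2 ^+ k)).
Proof.
rewrite /eval_at [shear_aut F]/(F \mPo _) /= comp_mpoly_meval; apply: meval_eq => i.
case: (ord2P i) => -> /=; rewrite (tnth_nth 0) /=.
  by rewrite mevalD rmorphXn /= !mevalXU.
by rewrite !mevalD mevalM mevalC mevalD rmorphXn /= !mevalXU.
Qed.

End Automorphism.

(** * The theorem *)

(** Any direction [t] at which the top form does not vanish will do; the degree is
    positive because the Jacobian is not zero. *)
Lemma monic_shear (K : closedFieldType) (F G : {mpoly K[2]}) (c : K) :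
  c != 0 -> jacobian F G = c%:MP ->
  exists (t lam : K) (d : nat), let B := lam^-1%:P%:P * shear t F in
    [/\ lam != 0, (0 < d)%N, B \is monic, size B = d.+1 &
        B^`() * dy (shear t G) - dy B * (shear t G)^`() = (c / lam)%:P%:P].
Proof.
move=> c0 eJ.
have F0 : F != 0.
  apply/eqP => F0; move/eqP: eJ; rewrite F0 /jacobian !mderiv0 !mul0r subrr eq_sym.
  by rewrite mpolyC_eq0 (negPf c0).
have [t] := elimT (closed_nonrootP _) (top_form_neq0 F0); rewrite rootE.
set lam := _.[t] => lam0; have dF := esym (mlead_deg F0).
set d := mdeg (mlead F) in dF; have [sF topF] := shear_top t dF.
rewrite -/lam in topF; have sJ := shear_jacobian t eJ.
exists t, lam, d; cbv zeta; set B := _ * _.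
have sB : (size B <= d.+1)%N.
  by rewrite /B mul_polyC; apply: leq_trans (size_scale_leq _ _) sF.
have Bd : B`_d = 1 by rewrite /B coefCM topF -polyCM mulVf.
have sB' : size B = d.+1.
  apply/eqP; rewrite eqn_leq sB ltnNge; apply/negP => /(nth_default 0).
  by move/eqP; rewrite Bd oner_eq0.
split=> //.
- rewrite lt0n; apply/negP => /eqP d0; rewrite d0 in sF topF.
  move: sJ; rewrite (size1_polyC sF) topF => /eqP; rewrite derivC dyC derivC !mul0r subrr eq_sym !polyC_eq0.
  exact/negP.
- by apply/monicP; rewrite lead_coefE sB' Bd.
have -> : (c / lam)%:P%:P = lam^-1%:P%:P * c%:P%:P :> {poly {poly K}}.
  by rewrite mulrC !polyCM.
rewrite -sJ /B; move: (shear t F) (shear t G) => f g.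
by rewrite derivM dyM dyC !derivC; ring.
Qed.

Lemma normc_complex (R : realType) (z : R[i]) : `|z| = (cabs z)%:C%C.
Proof. by []. Qed.

Theorem theorem1p2 (R : realType) (F G : {mpoly R[i][2]})
  (hJ : jacobian_pair F G)
  (hninj : ~ injective (keller_map F G)) :
  exists phi : {lrmorphism {mpoly R[i][2]} -> {mpoly R[i][2]}},
    [/\ bijective phi,
        jacobian_pair (phi F) (phi G)
      & forall eps : R, 0 < eps ->
          exists2 M : R, 0 < M &
            forall p1 p2 : R[i] * R[i],
              double_points (phi F) (phi G) p1 p2 ->
              M <= height p1 p2 ->
              cabs p1.2 + cabs p2.2 <= eps * height p1 p2].
Proof.
have [c c0 eJ] := hJ.
have [t [lam [d [lam0 d0 monB sB eB]]]] := monic_shear c0 eJ.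
have clam0 : c / lam != 0 by rewrite mulf_neq0 ?invr_eq0.
have [k Hk] := dominated_double_points_bounded d0 monB sB clam0 eB.
exists (shear_aut t k); split; first exact: shear_aut_bij.
  exists c; [exact: c0 | exact: (shear_aut_jacobian t k eJ)].
move=> eps eps0.
have C0 : 0 <= (eps^-1)%:C%C :> R[i] by rewrite (lecR 0) invr_ge0 ltW.
have [M [M1 HM]] := Hk _ C0.
have M1' : 1 <= complex.Re M by move: M1; rewrite lecE => /andP[].
have eM : M = (complex.Re M)%:C%C.
  by move: M1; rewrite lecE => /andP[/eqP /= im _]; case: (M) im => a b /= ->.
exists (complex.Re M / eps); first by rewrite divr_gt0 // (lt_le_trans ltr01).
move=> [x1 y1] [x2 y2] [ne eK] /= leh; set h := height _ _ in leh *.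
rewrite leNgt; apply/negP => ltY; apply: ne.
have cabs0 (u : R[i]) : 0 <= cabs u by rewrite -lecR -normc_complex normr_ge0.
have le_h1 : cabs x1 <= h.
  by rewrite /h /height /= -!addrA lerDl !addr_ge0.
have le_h2 : cabs x2 <= h.
  by rewrite /h /height /= -addrA addrCA lerDl !addr_ge0.
have leC (u : R[i]) : cabs u <= h -> `|u| <= (eps^-1)%:C%C * (`|y1| + `|y2|).
  move=> leu; rewrite !normc_complex -rmorphD -rmorphM lecR.
  by rewrite (le_trans leu) // mulrC ler_pdivlMr // mulrC ltW.
(* [Y > eps * h >= M] *)
have leM : M <= `|y1| + `|y2|.
  rewrite eM !normc_complex -rmorphD lecR; apply: le_trans (ltW ltY).
  by rewrite mulrC -ler_pdivrMr.
have /= eF := congr1 fst eK; have /= eG := congr1 snd eK.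
rewrite (eval_shear_aut t k F (x1, y1)) (eval_shear_aut t k F (x2, y2)) in eF.
rewrite (eval_shear_aut t k G (x1, y1)) (eval_shear_aut t k G (x2, y2)) in eG.
move: eF eG; rewrite -!ev2_shear => eF eG.
have eB12 : ev2 (lam^-1%:P%:P * shear t F) (x1 + y1 ^+ k) y1 =
            ev2 (lam^-1%:P%:P * shear t F) (x2 + y2 ^+ k) y2.
  by rewrite !ev2M eF !ev2C !hornerC.
by have [-> ->] := HM x1 y1 x2 y2 (leC _ le_h1) (leC _ le_h2) eB12 eG leM.
Qed.
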